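(* Let $A,B$ be finite-dimensional quantum systems with $d_A\le d_B$ and $d=\min(d_A,d_B)=d_A$. Consider the maximization of the entanglement generation rate $\Gamma(\psi,H)$ over all pure states $|\psi\rangle$ of $AB$ and all Hamiltonians $H$ on $A\otimes B$ with energy variance $\langle\psi|H^2|\psi\rangle-\langle\psi|H|\psi\rangle^2=1$ (no ancillas). An optimal initial state is $$|\psi^{opt}\rangle_{AB}=\sqrt{\gamma}\,|00\rangle+\sqrt{\frac{1-\gamma}{d-1}}\sum_{i=1}^{d_A-1}|ii\rangle,$$ where $\gamma\in(0,1)$ is chosen such that the probability distribution $\big(\gamma,\frac{1-\gamma}{d-1},\dots,\frac{1-\gamma}{d-1}\big)$ maximizes the variance of the surprisal. The optimal Hamiltonian is $$H=i\big(|00\rangle\langle\phi|-|\phi\rangle\langle00|\big),\qquad |\phi\rangle=\frac{1}{\sqrt{d-1}}\sum_{i=1}^{d_A-1}|ii\rangle.$$ Therefore $$\max\Gamma(\psi,H)=\max_{\gamma}\,2\sqrt{\gamma(1-\gamma)}\,\log\!\Big(\frac{\gamma(d-1)}{1-\gamma}\Big).$$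
   Context: For a pure bipartite state $|\psi\rangle$ and a Hermitian operator (Hamiltonian) $H$ on $A\otimes B$, $\Gamma(\psi,H):=\frac{d}{dt}E\big(e^{-iHt}|\psi\rangle\langle\psi|e^{iHt}\big)\big|_{t=0}$, where $E$ is the relative entropy of entanglement; on pure states $E$ equals the entanglement entropy $-\mathrm{Tr}(\rho_A\log\rho_A)$, $\rho_A=\mathrm{Tr}_B|\psi\rangle\langle\psi|$. $A$ and $B$ have orthonormal bases labelled $|0\rangle,|1\rangle,\dots$, and $|ii\rangle=|i\rangle_A|i\rangle_B$. The variance of the surprisal of a probability distribution $(p_1,\dots,p_d)$ is the variance of $\log p_i$ with respect to that distribution, $\sum_ip_i\log^2p_i-\big(\sum_ip_i\log p_i\big)^2$.
   Formalization: The printed H has the wrong sign: with evolution e^{-iHt} it gives minus the maximum when γ>1/d. The formal optimal Hamiltonian is -H = i(|φ><00| - |00><φ|) for γ>1/d, and the printed H otherwise (which occurs only for d=2, γ<1/2). *)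

(* Defs.v *)
From HB Require Import structures.
From mathcomp Require Import all_boot all_order all_algebra.
From mathcomp Require Import complex mxtens.
From mathcomp Require Import all_classical all_reals all_analysis.

Set Implicit Arguments.
Unset Strict Implicit.
Unset Printing Implicit Defensive.

Import Order.TTheory GRing.Theory Num.Theory.
Import numFieldNormedType.Exports.

Local Open Scope classical_set_scope.
Local Open Scope ring_scope.
Local Open Scope complex_scope.
Local Open Scope sesquilinear_scope.

Definition is_max (R : realType) (S : set R) (m : R) : Prop :=
  S m /\ ubound S m.

(* Functional calculus of a Hermitian matrix A = P^-1 diag(l) P: the matrix
   P^-1 diag(f l) P.  The eigenvalues l of a Hermitian A are real, so taking
   real parts only moves them from R[i] to R. *)
Definition hermfun (R : realType) (n : nat) (f : R -> R[i]) (A : 'M[R[i]]_n) :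
    'M[R[i]]_n :=
  invmx (spectralmx A)
    *m diag_mx (map_mx (fun z => f (complex.Re z)) (spectral_diag A))
    *m spectralmx A.

(* e^(-i H t) *)
Definition evolution (R : realType) (n : nat) (H : 'M[R[i]]_n) (t : R) :
    'M[R[i]]_n :=
  hermfun (fun x => cos (t * x) -i* sin (t * x)) H.

(* - Tr (rho log rho), natural logarithm.  Since ln 0 = 0 in the library, a zero
   eigenvalue contributes 0. *)
Definition entropy (R : realType) (n : nat) (rho : 'M[R[i]]_n) : R :=
  - complex.Re (\tr (rho *m hermfun (fun x => (ln x)%:C) rho)).

(* The space A (x) B is R[i]^(dA * dB), with |i>_A |j>_B in position
   mxtens_index (i, j), as for the library's Kronecker product tensmx. *)
Definition ptraceB (R : realType) (dA dB : nat) (rho : 'M[R[i]]_(dA * dB)) :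
    'M[R[i]]_dA :=
  \matrix_(i, j) \sum_(k < dB) rho (mxtens_index (i, k)) (mxtens_index (j, k)).

(* Value on pure states rho = |psi><psi| of the relative entropy of
   entanglement. *)
Definition entanglement (R : realType) (dA dB : nat)
    (rho : 'M[R[i]]_(dA * dB)) : R :=
  entropy (ptraceB rho).

(* The derivative exists for every pure state and every Hermitian H, including
   states of deficient Schmidt rank: an eigenvalue of the reduced state that
   vanishes at t = 0 is O(t^2).  So the default value that derive1 takes at a
   point of non-differentiability plays no role. *)
Definition Gamma (R : realType) (dA dB : nat) (psi : 'cV[R[i]]_(dA * dB))
    (H : 'M[R[i]]_(dA * dB)) : R :=
  derive1 (fun t : R =>
    entanglement (evolution H t *m (psi *m psi ^t*) *m evolution H (- t))) 0.

Definition pure_state (R : realType) (n : nat) (psi : 'cV[R[i]]_n) : Prop :=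
  psi ^t* *m psi = 1%:M.

Definition expectation (R : realType) (n : nat) (psi : 'cV[R[i]]_n)
    (X : 'M[R[i]]_n) : R[i] :=
  (psi ^t* *m X *m psi) 0 0.

Definition energy_variance (R : realType) (n : nat) (psi : 'cV[R[i]]_n)
    (H : 'M[R[i]]_n) : R[i] :=
  expectation psi (H *m H) - expectation psi H ^+ 2.

Definition admissible (R : realType) (dA dB : nat) (psi : 'cV[R[i]]_(dA * dB))
    (H : 'M[R[i]]_(dA * dB)) : Prop :=
  [/\ pure_state psi, H \is hermsymmx & energy_variance psi H = 1].

Definition ket (R : realType) (d : nat) (k : nat) : 'cV[R[i]]_d :=
  \col_(j < d) ((j : nat) == k)%:R.

(* |kk> = |k>_A |k>_B *)
Definition ket2 (R : realType) (dA dB : nat) (k : nat) : 'cV[R[i]]_(dA * dB) :=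
  tensmx (ket R dA k) (ket R dB k).

Definition psi_opt (R : realType) (dA dB : nat) (gamma : R) :
    'cV[R[i]]_(dA * dB) :=
  (Num.sqrt gamma)%:C *: ket2 R dA dB 0
  + (Num.sqrt ((1 - gamma) / (dA%:R - 1)))%:C
      *: \sum_(1 <= k < dA) ket2 R dA dB k.

Definition phi (R : realType) (dA dB : nat) : 'cV[R[i]]_(dA * dB) :=
  ((Num.sqrt (dA%:R - 1 : R))^-1)%:C *: \sum_(1 <= k < dA) ket2 R dA dB k.

(* i (|00><phi| - |phi><00|) *)
Definition ham (R : realType) (dA dB : nat) : 'M[R[i]]_(dA * dB) :=
  'i%C *: (ket2 R dA dB 0 *m (phi R dA dB) ^t*
         - phi R dA dB *m (ket2 R dA dB 0) ^t*).

(* With the evolution e^(-i H t), H = ham raises the weight gamma of |00> in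
   psi_opt and - ham lowers it.  The entropy of psi_opt increases with gamma
   below the uniform weight 1/d and decreases with gamma above it, so the sign
   for which the entropy grows depends on the side of 1/d on which gamma lies.
   The weights gamma < 1/d matter only when d = 2, where gamma and 1 - gamma
   have the same variance of the surprisal. *)
Definition ham_opt (R : realType) (dA dB : nat) (gamma : R) :
    'M[R[i]]_(dA * dB) :=
  if dA%:R^-1 < gamma then - ham R dA dB else ham R dA dB.

Definition prob_dist (R : realType) (d : nat) : set ('I_d -> R) :=
  [set p | (forall i, 0 <= p i) /\ \sum_i p i = 1].

Definition surprisal_variance (R : realType) (d : nat) (p : 'I_d -> R) : R :=
  \sum_i p i * ln (p i) ^+ 2 - (\sum_i p i * ln (p i)) ^+ 2.

Definition spike_dist (R : realType) (d : nat) (gamma : R) : 'I_d -> R :=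
  fun i => if (i : nat) == 0%N then gamma else (1 - gamma) / (d%:R - 1).

(* The maximality is among all probability distributions on d points. *)
Definition optimal_weight (R : realType) (d : nat) (gamma : R) : Prop :=
  0 < gamma < 1 /\
  is_max [set surprisal_variance p | p in @prob_dist R d]
    (surprisal_variance (@spike_dist R d gamma)).

(* Main.v *)
Require Import Defs.
From HB Require Import structures.
From mathcomp Require Import all_boot all_order all_algebra.
From mathcomp Require Import complex mxtens.
From mathcomp Require Import all_classical all_reals all_analysis.
From mathcomp Require Import ring lra.

Import Order.TTheory GRing.Theory Num.Theory.
Import numFieldNormedType.Exports.

Local Open Scope classical_set_scope.
Local Open Scope ring_scope.

(** By Klein's inequality the entropy of the evolved reduced state is at most
    [- Tr rho(t) ln sigma + Tr sigma - 1] for every positive [sigma]. Taking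
    for [sigma] the initial reduced state, with its zero eigenvalues replaced
    by [t^2], gives [S(t) <= S(0) + t x + o(t)], where [x] is the derivative at
    [0] of the expectation of [- ln rho (x) 1]. By the uncertainty relation
    [x] is at most twice the standard deviation of that observable, i.e. of the
    surprisal of the spectrum [p] of [rho]. So the rate is at most
    [2 sqrt V(p)].

    The variance [V] attains its maximum on the simplex, and moving weight
    between two positive entries [p_i <> p_j] of a maximizer shows that
    [ln p_i + ln p_j] does not depend on the pair. So [p] has at most two
    positive values, and [V(p)] is bounded by the variance of a spike.

    On the two-dimensional space spanned by [|00>] and [phi] the evolution is
    an explicit rotation and the reduced state remains diagonal, which gives
    the rate [2 sqrt V(spike)] for the optimal pair. *)

Set Implicit Arguments.
Unset Strict Implicit.
Unset Printing Implicit Defensive.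

(** * Maximal variance of the surprisal *)

Section Scalar.
Variable R : realType.
Implicit Types x y t : R.

Definition xlnx x : R := x * ln x.
Definition xln2x x : R := x * ln x ^+ 2.

(** With [s] the fourth root of [x > 0], the expression equals [16 s^2 (s ln s)^2], and
    [|s ln s| <= 1] because [ln (1/s) < 1/s]. For [x <= 0] it vanishes by the default value of [ln].
    The bound gives continuity at the points [x <= 0] by squeezing. *)
Lemma xln2x_le_sqrt x : x <= 1 -> 0 <= xln2x x <= 16 * Num.sqrt x.
Proof.
move=> x1; rewrite /xln2x.
have [x0|x0] := leP x 0.
  by rewrite ln0// expr0n/= mulr0 lexx mulr_ge0// sqrtr_ge0.
rewrite mulr_ge0 ?sqr_ge0 ?(ltW x0)//=.
set s := Num.sqrt (Num.sqrt x).
have s0 : 0 < s by rewrite !sqrtr_gt0.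
have s2 : s ^+ 2 = Num.sqrt x by rewrite sqr_sqrtr// sqrtr_ge0.
have s4 : s ^+ 4 = x by rewrite (exprM s 2 2) s2 sqr_sqrtr// ltW.
have s1 : s <= 1 by rewrite -(@expr_le1 _ 4) ?(ltW s0)// s4.
have lns : `|s * ln s| <= 1.
  have lns0 : ln s <= 0 by exact: ln_le0.
  rewrite normrM (gtr0_norm s0) ler0_norm// -lnV ?posrE//.
  have: ln s^-1 < s^-1 by apply: ln_sublinear; rewrite invr_gt0.
  by move/ltW/(ler_wpM2l (ltW s0)); rewrite mulfV ?gt_eqF.
rewrite -s2 -s4 lnXn//.
have -> : s ^+ 4 * (ln s *+ 4) ^+ 2 = 16 * s ^+ 2 * (s * ln s) ^+ 2 by rewrite -mulr_natl; ring.
rewrite -{2}[16 * _]mulr1 ler_wpM2l//; first by rewrite mulr_ge0 ?sqr_ge0.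
by rewrite -real_normK ?num_real// expr_le1// normr_ge0.
Qed.

Lemma is_derive_xlnx x : 0 < x -> is_derive x 1 (xlnx : R -> R) (ln x + 1).
Proof.
move=> x0; have dln := is_derive1_ln x0.
have -> : (xlnx : R -> R) = id * (@ln R) by [].
apply: is_derive_eq; rewrite /GRing.scale/= mulr1 mulfV ?gt_eqF//.
by rewrite addrC.
Qed.

Lemma is_derive_xln2x x :
  0 < x -> is_derive x 1 (xln2x : R -> R) (ln x ^+ 2 + 2 * ln x).
Proof.
move=> x0; have dln := is_derive1_ln x0.
have -> : (xln2x : R -> R) = id * (@ln R) ^+ 2 by [].
apply: is_derive_eq; rewrite /GRing.scale/= mulr1 fctE/= addrC; congr (_ + _).
rewrite -mulr_natl; field; exact: lt0r_neq0.
Qed.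

Lemma continuous_xln2x : continuous (xln2x : R -> R).
Proof.
move=> x; have [x0|x0] := ltP 0 x.
  apply/differentiable_continuous/derivable1_diffP.
  by have [] := is_derive_xln2x x0.
rewrite /continuous_at; have -> : xln2x x = 0 by rewrite /xln2x ln0// expr0n/= mulr0.
apply: (@squeeze_cvgr _ _ _ _ (cst 0) (fun t => 16 * Num.sqrt t)).
- near=> t; apply: xln2x_le_sqrt.
  near: t; apply: (cvgr_le x); [exact: cvg_id|exact: le_lt_trans ltr01].
- exact: cvg_cst.
- rewrite -[X in _ --> X](mulr0 16); apply: cvgM; first exact: cvg_cst.
  by have := @sqrt_continuous R x; rewrite /continuous_at ler0_sqrtr.
Unshelve. all: by end_near. Qed.

(** Follows from [|l| <= 1 + l^2] at [l = ln x], since [x] and [x ln^2 x] are both bounded by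
    multiples of [sqrt x]. *)
Lemma xlnx_norm_le_sqrt x : x <= 1 -> `|xlnx x| <= 17 * Num.sqrt x.
Proof.
move=> x1; rewrite /xlnx; have [x0|x0] := leP x 0.
  by rewrite ln0// mulr0 normr0 mulr_ge0// sqrtr_ge0.
have /andP[_ h] := xln2x_le_sqrt x1.
have {}h : x * (1 + ln x ^+ 2) <= 17 * Num.sqrt x.
  have : x <= Num.sqrt x.
    have s0 := sqrtr_ge0 x; have s2 : Num.sqrt x ^+ 2 = x by rewrite sqr_sqrtr ?ltW.
    have : Num.sqrt x <= 1 by rewrite -sqrtr1 ler_wsqrtr.
    nra.
  by move: h; rewrite /xln2x; lra.
apply: le_trans h; rewrite normrM (gtr0_norm x0) ler_wpM2l ?(ltW x0)//.
by rewrite -[ln x ^+ 2]real_normK ?num_real//; nra.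
Qed.

Lemma continuous_xlnx : continuous (xlnx : R -> R).
Proof.
move=> x; have [x0|x0] := ltP 0 x.
  apply/differentiable_continuous/derivable1_diffP.
  by have [] := is_derive_xlnx x0.
rewrite /continuous_at; have -> : xlnx x = 0 by rewrite /xlnx ln0// mulr0.
have h : 17 * Num.sqrt t @[t --> x] --> (0 : R).
  rewrite -[X in _ --> X](mulr0 (17 : R)).
  apply: (@cvgM _ _ _ _ (cst 17) (fun t : R => Num.sqrt t) 17 0).
    exact: cvg_cst.
    by have := @sqrt_continuous R x; rewrite /continuous_at ler0_sqrtr.
apply: (@squeeze_cvgr _ _ _ _ (fun t => - (17 * Num.sqrt t))
  (fun t => 17 * Num.sqrt t)) => //.
- have : \forall t \near x, t <= 1.
    exact: (cvgr_le x cvg_id 1 (le_lt_trans x0 ltr01)).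
  by apply: filterS => t t1; rewrite -ler_norml; exact: xlnx_norm_le_sqrt.
- by have := cvgN h; rewrite oppr0; apply; exact: nbhs_filter.
Qed.

End Scalar.

(** * Existence of a maximizer and its stationarity condition *)

Section Simplex.
Variable R : realType.

Lemma compact_simplex d :
  compact [set v : 'rV[R]_d | (forall i, 0 <= v 0 i) /\ \sum_i v 0 i = 1].
Proof.
have cbox : compact [set v : 'rV[R]_d | forall i, (`[0, 1]%classic : set R) (v ord0 i)].
  exact: (@rV_compact R d (fun=> `[0, 1]%classic) (fun=> @segment_compact R 0 1)).
have csum : continuous (fun v : 'rV[R]_d => \sum_i v 0 i).
  apply: continuous_big => [|i _]; last exact: coord_continuous.
  exact: add_continuous.
have clsum : closed [set v : 'rV[R]_d | \sum_i v 0 i = 1].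
  exact: (closed_comp (fun v _ => csum v) (@closed_eq R 1)).
have := compact_closedI cbox clsum; congr compact; apply/seteqP; split => v /=.
  by case=> vbox v1; split => // i; have := vbox i; rewrite in_itv/= => /andP[].
case=> v0 v1; split => // i; rewrite in_itv/= v0/= -v1 (bigD1 i)//= lerDl.
exact: sumr_ge0.
Qed.

Lemma continuous_surprisal_variance d :
  continuous (fun v : 'rV[R]_d => surprisal_variance (fun i => v 0 i)).
Proof.
have cterm (g : R -> R) : continuous g ->
    continuous (fun v : 'rV[R]_d => \sum_i g (v 0 i)).
  move=> cg; apply: continuous_big => [|i _]; first exact: add_continuous.
  move=> v; apply: (@continuous_comp _ _ _ (fun v : 'rV[R]_d => v 0 i) g v).
    exact: coord_continuous.
  exact: cg.
move=> v; apply: (@continuousB _ _ _ (fun v : 'rV[R]_d => \sum_i xln2x (v 0 i))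
  (fun v : 'rV[R]_d => (\sum_i xlnx (v 0 i)) ^+ 2)).
  exact/cterm/continuous_xln2x.
apply: (@continuous_comp _ _ _ (fun v : 'rV[R]_d => \sum_i xlnx (v 0 i)) (fun x : R => x ^+ 2) v).
  exact/cterm/continuous_xlnx.
exact: exprn_continuous.
Qed.

Lemma exists_max_surprisal_variance d : (0 < d)%N ->
  exists2 p : 'I_d -> R, prob_dist p &
    forall q : 'I_d -> R, prob_dist q -> surprisal_variance q <= surprisal_variance p.
Proof.
move=> d0.
have ne : [set v : 'rV[R]_d | (forall i, 0 <= v 0 i) /\ \sum_i v 0 i = 1] !=set0.
  exists (\row_j (j == Ordinal d0)%:R); split=> [i|]; first by rewrite mxE ler0n.
  rewrite (bigD1 (Ordinal d0))//= mxE eqxx big1 ?addr0// => i /negbTE h.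
  by rewrite mxE h.
have [v vA vmax] := EVT_max_rV ne (@compact_simplex d)
  (continuous_subspaceT (@continuous_surprisal_variance d)).
exists (fun i => v 0 i); first by move: vA; rewrite inE.
move=> q [q0 q1]; have := vmax (\row_i q i).
have e : (fun i => (\row_i q i) 0 i) = q by apply/funext => i; rewrite mxE.
rewrite e; apply; rewrite inE /=; split; first by move=> i; rewrite mxE.
by under eq_bigr do rewrite mxE.
Qed.

(* Stationarity when weight is moved from p_j to p_i. *)
Lemma max_surprisal_variance_pair d (p : 'I_d -> R) i j :
  prob_dist p ->
  (forall q : 'I_d -> R, prob_dist q -> surprisal_variance q <= surprisal_variance p) ->
  0 < p i -> 0 < p j -> p i != p j ->
  ln (p i) + ln (p j) = 2 * (\sum_k p k * ln (p k)) - 2.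
Proof.
move=> [p0 p1] pmax pi0 pj0 pij.
have ij : j != i by apply: contraNneq pij => ->.
(* The curve [q x] keeps the total weight [s] of the pair and all other entries. It passes through
   [p] at [x = p i], an interior point of []0, s[], so the derivative of the variance vanishes
   there. *)
set s := p i + p j; pose q x k := if k == i then x else if k == j then s - x else p k.
have qsum (g : R -> R) x : \sum_k g (q x k) =
    g x + (g (s - x) + \sum_(k | (k != i) && (k != j)) g (p k)).
  rewrite (bigD1 i)//= (bigD1 j)//= /q eqxx (negbTE ij) eqxx; congr (_ + (_ + _)).
  by apply: eq_bigr => k /andP[/negbTE -> /negbTE ->].
have qp : q (p i) = p.
  apply/funext => k; rewrite /q; have [->//|_] := eqVneq k i.
  by have [->|//] := eqVneq k j; rewrite /s addrC addKr.
pose A := \sum_(k | (k != i) && (k != j)) xln2x (p k).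
pose B := \sum_(k | (k != i) && (k != j)) xlnx (p k).
pose F x := xln2x x + (xln2x (s - x) + A) - (xlnx x + (xlnx (s - x) + B)) ^+ 2.
have FV x : surprisal_variance (q x) = F x.
  by rewrite /surprisal_variance (qsum (@xln2x R)) (qsum (@xlnx R)).
have qdist x : x \in `]0, s[ -> prob_dist (q x).
  rewrite in_itv/= => /andP[x0 xs]; split.
    by move=> k; rewrite /q; case: ifP => _; [exact: ltW|case: ifP => // _; rewrite subr_ge0 ltW].
  have := qsum id (p i); rewrite (qsum id x) qp p1 /s => ->; ring.
have pis : p i \in `]0, s[ by rewrite in_itv/= pi0/= ltrDl.
have dF x : x \in `]0, s[ -> is_derive x 1 F (
    ln x ^+ 2 + 2 * ln x - (ln (s - x) ^+ 2 + 2 * ln (s - x))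
    - 2 * (xlnx x + (xlnx (s - x) + B)) * (ln x - ln (s - x))).
  rewrite in_itv/= => /andP[x0 xs]; have sx0 : 0 < s - x by rewrite subr_gt0.
  have ds : is_derive x 1 (fun y : R => s - y) (-1).
    by apply: is_derive_eq; rewrite add0r mul1r.
  have d1 := is_derive_xln2x x0; have d2 := is_derive_xlnx x0.
  have e1 := is_derive_xln2x sx0; have e2 := is_derive_xlnx sx0.
   have d3 : is_derive x 1 (fun y => xln2x (s - y)) (-1 * (ln (s - x) ^+ 2 + 2 * ln (s - x))).
    by have := @is_derive1_comp R (@xln2x R) (fun y => s - y) x _ _ e1 ds; rewrite mulrC.
  have d4 : is_derive x 1 (fun y => xlnx (s - y)) (-1 * (ln (s - x) + 1)).
    by have := @is_derive1_comp R (@xlnx R) (fun y => s - y) x _ _ e2 ds; rewrite mulrC.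
  have dS := is_deriveD d2 (is_deriveD d4 (is_derive_cst B x 1)).
  have dF := is_deriveB (is_deriveD d1 (is_deriveD d3 (is_derive_cst A x 1)))
    (is_deriveM dS dS).
  apply: (is_derive_eq dF); rewrite /GRing.scale/=.
  have -> : (@xlnx R + ((fun y => xlnx (s - y)) + cst B)) x =
    xlnx x + (xlnx (s - x) + B) by [].
  by ring.
have s0 : 0 <= s by rewrite addr_ge0.
have := derive1_at_max s0 (fun t ht => @ex_derive _ _ _ _ _ _ _ (dF t ht)) pis.
have hmax t : t \in `]0, s[ -> F t <= F (p i).
  by move=> ts; rewrite -!FV qp; apply/pmax/qdist.
move=> /(_ hmax) D0; have := @derive_val _ _ _ _ _ _ _ D0.
rewrite (@derive_val _ _ _ _ _ _ _ (dF _ pis)).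
have sp : s - p i = p j by rewrite /s addrC addKr.
rewrite sp.
have -> : xlnx (p i) + (xlnx (p j) + B) = \sum_k p k * ln (p k).
  by have := qsum (@xlnx R) (p i); rewrite qp sp => <-.
(* With [S] the sum of the [p k * ln (p k)], the vanishing derivative factors as [(ln (p i) - ln (p
   j)) (ln (p i) + ln (p j) + 2 - 2 S)], and the first factor is nonzero. *)
move=> e; have lij : ln (p i) - ln (p j) != 0.
  by rewrite subr_eq0; apply: contra_neq pij => /ln_inj; apply; rewrite posrE.
apply/eqP; rewrite -subr_eq0; apply/eqP/(mulfI lij); rewrite mulr0 -[RHS]e; ring.
Qed.

End Simplex.

(** * Reduction of a maximizer to a spike *)

Section Spike.
Variable R : realType.

Lemma natrS_subr1 n : n.+1%:R - 1 = n%:R :> R.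
Proof. by rewrite -natr1 addrK. Qed.

Lemma spike_dist_sum (g : R -> R) n gamma :
  \sum_i g (@spike_dist R n.+2 gamma i) =
  g gamma + n.+1%:R * g ((1 - gamma) / n.+1%:R).
Proof.
rewrite big_ord_recl /spike_dist/= natrS_subr1; congr (_ + _).
by rewrite sumr_const card_ord mulr_natl.
Qed.

Lemma prob_dist_spike n gamma : 0 < gamma < 1 ->
  prob_dist (@spike_dist R n.+2 gamma).
Proof.
move=> /andP[g0 g1]; split.
  move=> i; rewrite /spike_dist; case: ifP => _; first exact: ltW.
  by rewrite natrS_subr1 divr_ge0 ?ler0n// subr_ge0 ltW.
rewrite (spike_dist_sum id) mulrC divfK ?pnatr_eq0//; ring.
Qed.

Lemma surprisal_variance_spike n gamma : 0 < gamma < 1 ->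
  surprisal_variance (@spike_dist R n.+2 gamma) =
  gamma * (1 - gamma) * ln (gamma * n.+1%:R / (1 - gamma)) ^+ 2.
Proof.
move=> /andP[g0 g1]; have g1' : 0 < 1 - gamma by rewrite subr_gt0.
have n0 : 0 < n.+1%:R :> R by rewrite ltr0n.
rewrite /surprisal_variance (spike_dist_sum (@xln2x R)) (spike_dist_sum (@xlnx R)).
rewrite /xln2x /xlnx !mulrA [n.+1%:R * (1 - gamma)]mulrC mulfK ?gt_eqF//.
rewrite !ln_div ?posrE ?mulr_gt0// lnM ?posrE//; ring.
Qed.

Lemma two_sqrt_variance_spike n gamma : 0 < gamma < 1 ->
  2 * Num.sqrt (surprisal_variance (@spike_dist R n.+2 gamma)) =
  2 * Num.sqrt (gamma * (1 - gamma)) * `|ln (gamma * n.+1%:R / (1 - gamma))|.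
Proof.
move=> g01; have /andP[g0 g1] := g01.
rewrite surprisal_variance_spike// sqrtrM ?sqrtr_sqr ?mulrA//.
by rewrite mulr_ge0 ?subr_ge0 ?ltW.
Qed.

(** Here [L] is the log-ratio of two levels of total weights [gamma] and [1 - gamma]. Exchanging the
    levels replaces [gamma] by [1 - gamma] and [L] by [- L], so [gamma] may be taken at least [1/2].
    Then the first of the two logarithmic bounds is the larger one and bounds [|L|]. So [gamma'] is
    the larger of the two weights. *)
Lemma two_level_variance_le (D gamma L : R) : 1 <= D -> 0 < gamma < 1 ->
  L <= ln (gamma * D / (1 - gamma)) -> - L <= ln ((1 - gamma) * D / gamma) ->
  exists2 gamma', 2^-1 <= gamma' < 1 &
    gamma * (1 - gamma) * L ^+ 2 <=
    gamma' * (1 - gamma') * ln (gamma' * D / (1 - gamma')) ^+ 2.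
Proof.
move=> D1; wlog g2 : gamma L / 2^-1 <= gamma.
  move=> H /andP[g0 g1] L1 L2; have [g2|g2] := leP 2^-1 gamma; first by apply: H => //; rewrite g0.
  have e : 1 - (1 - gamma) = gamma by ring.
  have [||||g' g'1 h] := H (1 - gamma) (- L).
  - lra.
  - lra.
  - by rewrite e.
  - by rewrite opprK e.
  by exists g' => //; move: h; rewrite sqrrN e [_ * gamma]mulrC.
move=> /andP[g0 g1] L1 L2; exists gamma; first by rewrite g2.
have g1' : 0 < 1 - gamma by rewrite subr_gt0.
have D0 : 0 < D by exact: lt_le_trans D1.
rewrite ler_wpM2l ?mulr_ge0 ?(ltW g0) ?(ltW g1')//.
have L3 : - L <= ln (gamma * D / (1 - gamma)).
  apply: le_trans L2 _; rewrite ler_ln ?posrE ?divr_gt0 ?mulr_gt0//.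
  rewrite ler_pdivrMr// mulrAC ler_pdivlMr//.
  suff : (1 - gamma) ^+ 2 <= gamma ^+ 2.
    move/(ler_wpM2l (ltW D0)); rewrite -[_ * D * _]mulrAC -[_ * D * gamma]mulrAC.
    by rewrite [D * _]mulrC [D * gamma ^+ 2]mulrC !expr2.
  by rewrite lerXn2r// ?nnegrE; lra.
rewrite -real_normK ?num_real// lerXn2r ?nnegrE ?normr_ge0//.
  by apply: le_trans (normr_ge0 L) _; rewrite ler_norml lerNl L3 L1.
by rewrite ler_norml lerNl L3 L1.
Qed.

(* At a maximizer the pairwise condition leaves at most two positive values a
   and b; then V = g (1 - g) (ln a - ln b)^2 with g the total weight of a, and
   both a / g and b / (1 - g) lie between 1 / (d - 1) and 1. *)
Lemma surprisal_variance_le_spike n : exists2 gamma : R, 2^-1 <= gamma < 1 &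
  forall q : 'I_n.+2 -> R, prob_dist q ->
    surprisal_variance q <= surprisal_variance (@spike_dist R n.+2 gamma).
Proof.
have [p pd pmax] := @exists_max_surprisal_variance R n.+2 isT.
suff [gamma g1 h] : exists2 gamma : R, 2^-1 <= gamma < 1 &
    surprisal_variance p <= gamma * (1 - gamma) * ln (gamma * n.+1%:R / (1 - gamma)) ^+ 2.
  exists gamma => // q /pmax/le_trans; apply; rewrite surprisal_variance_spike//.
  by case/andP: g1 => g1 ->; rewrite andbT; lra.
have [p0 p1] := pd.
have [i0 pi0] : exists i, 0 < p i.
  apply/existsP; apply: contraT; rewrite negb_exists => /forallP h.
  have : \sum_i p i = 0.
    by apply: big1 => i _; apply/eqP; rewrite eq_le p0 andbT leNgt.
  by rewrite p1 => /eqP; rewrite oner_eq0.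
set a := p i0 in pi0.
(* If [a] is the only positive value, the surprisal is constant on the support and the variance is
   [0], so the weight [1/2] serves. *)
have [/existsP[j0 /andP[pj0 pj0a]]|] := boolP [exists j, (0 < p j) && (p j != a)]; last first.
  rewrite negb_exists => /forallP h.
  have pa i : p i = 0 \/ p i = a.
    have := h i; have := p0 i; rewrite le_eqVlt => /orP[/eqP <-|->]; first by left.
    by rewrite negbK => /eqP; right.
  exists 2^-1; first by lra.
  have -> : surprisal_variance p = 0.
    have e (g : R -> R) : \sum_i p i * g (p i) = g a.
      transitivity (\sum_i p i * g a); last by rewrite -mulr_suml p1 mul1r.
      by apply: eq_bigr => i _; have [->|->] := pa i; rewrite ?mul0r.
    by rewrite /surprisal_variance (e (fun x => ln x ^+ 2)) (e (@ln R)) subrr.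
  by rewrite mulr_ge0 ?sqr_ge0//; lra.
set b := p j0 in pj0 pj0a.
have pab i : [\/ p i = 0, p i = a | p i = b].
  have := p0 i; rewrite le_eqVlt => /orP[/eqP <-|pi]; first exact: Or31.
  have [->|pia] := eqVneq (p i) a; first exact: Or32.
  apply: Or33; apply: ln_inj; rewrite ?posrE//.
  have := max_surprisal_variance_pair pd pmax pi pi0 pia.
  have := max_surprisal_variance_pair pd pmax pj0 pi0 pj0a.
  by rewrite -/a -/b => <- /addIr.
set D : R := n.+1%:R.
pose g := \sum_(i | p i == a) p i.
have gE : 1 - g = \sum_(i | p i != a) p i.
  have : \sum_i p i = g + \sum_(i | p i != a) p i by rewrite (bigID (fun i => p i == a)).
  by rewrite p1 => ->; rewrite addrC addKr.
have ag : a <= g by rewrite /g (bigD1 i0)//= lerDl sumr_ge0.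
have bg : b <= 1 - g by rewrite gE (bigD1 j0)//= lerDl sumr_ge0.
(* At most [D = n + 1] of the [n + 2] entries equal [a], because entry [j0] does not. In the same
   way at most [D] entries differ from [a], and each of these is [0] or [b]. *)
have gD : g <= D * a.
  rewrite /g (eq_bigr (fun=> a)); last by move=> i /eqP.
  rewrite sumr_const -mulr_natl ler_wpM2r ?ler_nat ?ltW//.
  have := max_card (fun i => p i == a); rewrite card_ord leq_eqVlt => /orP[/eqP e|//].
  exfalso.
  have := subset_cardP (etrans e (esym (card_ord n.+2))) (subset_predT _) j0.
  by rewrite !inE /in_mem /= -/b (negbTE pj0a).
have gD' : 1 - g <= D * b.
  rewrite gE; apply: (@le_trans _ _ (\sum_(i | p i != a) b)).
    apply: ler_sum => i pia; have [->|pi|->//] := pab i; first exact: ltW.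
    by rewrite pi eqxx in pia.
  rewrite sumr_const -mulr_natl ler_wpM2r ?ler_nat ?ltW//.
  have := max_card (fun i => p i != a); rewrite card_ord leq_eqVlt => /orP[/eqP e|//].
  exfalso.
  have := subset_cardP (etrans e (esym (card_ord n.+2))) (subset_predT _) i0.
  by rewrite !inE /in_mem /= -/a eqxx.
have g0 : 0 < g by exact: lt_le_trans ag.
have g1 : 0 < 1 - g by exact: lt_le_trans bg.
have D0 : 0 < D by rewrite ltr0n.
have -> : surprisal_variance p = g * (1 - g) * (ln a - ln b) ^+ 2.
  have e (f : R -> R) : \sum_i p i * f (p i) = g * f a + (1 - g) * f b.
    rewrite (bigID (fun i => p i == a))/= gE /g !mulr_suml; congr (_ + _).
      by apply: eq_bigr => i /eqP ->.
    apply: eq_bigr => i pia; have [->|pi|->//] := pab i; first by rewrite !mul0r.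
    by rewrite pi eqxx in pia.
  rewrite /surprisal_variance (e (fun x => ln x ^+ 2)) (e (@ln R)); ring.
apply: two_level_variance_le.
- by rewrite ler1n.
- by rewrite g0 -subr_gt0.
- rewrite -ln_div ?posrE// ler_ln ?posrE ?divr_gt0 ?mulr_gt0//.
  rewrite ler_pdivrMr// mulrAC ler_pdivlMr// -mulrA.
  by apply: ler_pM => //; exact: ltW.
- rewrite opprB -ln_div ?posrE// ler_ln ?posrE ?divr_gt0 ?mulr_gt0//.
  rewrite ler_pdivrMr// mulrAC ler_pdivlMr// -mulrA.
  by apply: ler_pM => //; exact: ltW.
Qed.

End Spike.

(** * Unitary conjugates of diagonal matrices *)

Section ComplexReal.
Local Open Scope complex_scope.
Local Open Scope sesquilinear_scope.
Variable R : realType.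
Local Notation C := R[i].

Lemma Re_sum (I : Type) (r : seq I) (P : pred I) (F : I -> C) :
  complex.Re (\sum_(i <- r | P i) F i) = \sum_(i <- r | P i) complex.Re (F i).
Proof. by rewrite (big_morph (@complex.Re R) (id1 := 0) (op1 := +%R))// => -[? ?] [? ?]. Qed.

Lemma Im_sum (I : Type) (r : seq I) (P : pred I) (F : I -> C) :
  complex.Im (\sum_(i <- r | P i) F i) = \sum_(i <- r | P i) complex.Im (F i).
Proof. by rewrite (big_morph (@complex.Im R) (id1 := 0) (op1 := +%R))// => -[? ?] [? ?]. Qed.

Lemma Re_realM (x : R) (z : C) : complex.Re (x%:C * z) = x * complex.Re z.
Proof. by case: z => a b /=; rewrite mul0r subr0. Qed.

Lemma conjC_real (x : R) : ((x%:C)^*)%R = x%:C :> C.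
Proof. exact: conjc_real. Qed.

End ComplexReal.

Section Adjoint.
Local Open Scope sesquilinear_scope.
Variable C : numClosedFieldType.

Lemma adjmxM m n p (A : 'M[C]_(m, n)) (B : 'M[C]_(n, p)) :
  (A *m B)^t* = B^t* *m A^t*.
Proof. by rewrite trmx_mul map_mxM. Qed.

Lemma adjmxE m n (A : 'M[C]_(m, n)) i j : A^t* i j = ((A j i)^*)%R.
Proof. by rewrite !mxE. Qed.

Lemma hermsymmx_adj n (A : 'M[C]_n) : (A \is hermsymmx) = (A == A^t*).
Proof. by rewrite is_hermitianmxE expr0 scale1r. Qed.

Lemma hermsymmxP n (A : 'M[C]_n) : reflect (A^t* = A) (A \is hermsymmx).
Proof. by rewrite hermsymmx_adj eq_sym; exact: eqP. Qed.

Definition dg n (f : 'I_n -> C) : 'M[C]_n := diag_mx (\row_i f i).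

(** A matrix in spectral form. With the unitary [Q] fixed, products, adjoints and functions of such
    matrices are computed pointwise on [f]. *)
Definition conjdg n (Q : 'M[C]_n) (f : 'I_n -> C) : 'M[C]_n :=
  Q^t* *m dg f *m Q.

Lemma unitarymxK n (Q : 'M[C]_n) : Q \is unitarymx -> Q^t* *m Q = 1%:M.
Proof. by move=> Qu; rewrite -invmx_unitary// mulVmx// unitarymx_unit. Qed.

Lemma dgM n (f g : 'I_n -> C) : dg f *m dg g = dg (fun i => f i * g i).
Proof.
rewrite /dg mulmx_diag; congr diag_mx; apply/rowP => i; by rewrite !mxE.
Qed.

Lemma conjdgM n (Q : 'M[C]_n) (f g : 'I_n -> C) : Q \is unitarymx ->
  conjdg Q f *m conjdg Q g = conjdg Q (fun i => f i * g i).
Proof.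
move=> Qu; rewrite /conjdg -dgM !mulmxA.
by rewrite -[X in X *m dg g *m Q]mulmxA (unitarymxP Qu) mulmx1.
Qed.

Lemma conjdg_adj n (Q : 'M[C]_n) (f : 'I_n -> C) :
  (conjdg Q f)^t* = conjdg Q (fun i => ((f i)^*)%R).
Proof.
have e : (dg f)^t* = dg (fun i => ((f i)^*)%R); last first.
  by rewrite /conjdg !adjmxM trmxCK mulmxA e.
apply/matrixP => i j; rewrite adjmxE !mxE rmorphMn/= eq_sym.
by case: eqP => [->|]; rewrite ?mulr0n.
Qed.

Lemma conjdg1 n (Q : 'M[C]_n) : Q \is unitarymx -> conjdg Q (fun=> 1) = 1%:M.
Proof.
move=> Qu; rewrite /conjdg (_ : dg _ = 1%:M) ?mulmx1 ?unitarymxK//.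
by apply/matrixP => i j; rewrite !mxE.
Qed.

Lemma tr_conjdg n (Q : 'M[C]_n) (f : 'I_n -> C) : Q \is unitarymx ->
  \tr (conjdg Q f) = \sum_i f i.
Proof.
move=> Qu; rewrite /conjdg mxtrace_mulC mulmxA (unitarymxP Qu) mul1mx mxtrace_diag.
by apply: eq_bigr => i _; rewrite mxE.
Qed.

Lemma spectral_conjdg n (A : 'M[C]_n) f :
  invmx (spectralmx A) *m diag_mx (\row_i f i) *m spectralmx A =
  conjdg (spectralmx A) f.
Proof. by rewrite invmx_unitary ?spectral_unitarymx. Qed.

Lemma normalmx_conjdg n (A : 'M[C]_n) : A \is normalmx ->
  A = conjdg (spectralmx A) (fun i => spectral_diag A 0 i).
Proof.
move=> /orthomx_spectralP {1}->; rewrite -spectral_conjdg.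
by suff {1}-> : spectral_diag A = \row_i spectral_diag A 0 i by []; apply/rowP => i; rewrite mxE.
Qed.

End Adjoint.

Section Eigs.
Local Open Scope complex_scope.
Local Open Scope sesquilinear_scope.
Variable R : realType.
Local Notation C := R[i].

Definition eigs n (A : 'M[C]_n) (i : 'I_n) : R := complex.Re (spectral_diag A 0 i).

Lemma hermfun_conjdg n (f : R -> C) (A : 'M[C]_n) :
  hermfun f A = conjdg (spectralmx A) (fun i => f (eigs A i)).
Proof.
rewrite -spectral_conjdg /hermfun.
suff -> : map_mx (fun z => f (complex.Re z)) (spectral_diag A) = \row_i f (eigs A i) by [].
by apply/rowP => i; rewrite !mxE.
Qed.

Lemma herm_conjdg n (A : 'M[C]_n) : A \is hermsymmx ->
  A = conjdg (spectralmx A) (fun i => (eigs A i)%:C).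
Proof.
move=> Ah; rewrite {1}(normalmx_conjdg (hermitian_normalmx Ah)).
suff -> : (fun i => spectral_diag A 0 i) = (fun i => (eigs A i)%:C) by [].
apply/funext => i; rewrite /eigs RRe_real//.
by have /mxOverP := hermitian_spectral_diag_real Ah; apply.
Qed.

Lemma entropy_eigs n (rho : 'M[C]_n) : rho \is hermsymmx ->
  entropy rho = - \sum_i eigs rho i * ln (eigs rho i).
Proof.
move=> rh; rewrite /entropy hermfun_conjdg {1}(herm_conjdg rh).
rewrite conjdgM ?spectral_unitarymx// tr_conjdg ?spectral_unitarymx// Re_sum.
by congr (- _); apply: eq_bigr => i _; rewrite Re_realM.
Qed.

End Eigs.

(** * Expectations and the uncertainty relation *)

Section Braket.
Local Open Scope sesquilinear_scope.
Variable C : numClosedFieldType.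

Lemma unitary_row_sum n (W : 'M[C]_n) i : W \is unitarymx ->
  \sum_j `|W i j| ^+ 2 = 1.
Proof.
move=> Wu; have /matrixP/(_ i i) := unitarymxP Wu; rewrite !mxE eqxx => h; rewrite -[RHS]h.
by apply: eq_bigr => j _; rewrite !mxE normCK.
Qed.

Lemma unitary_col_sum n (W : 'M[C]_n) j : W \is unitarymx ->
  \sum_i `|W i j| ^+ 2 = 1.
Proof.
move=> Wu; have /matrixP/(_ j j) := unitarymxK Wu; rewrite !mxE eqxx => h; rewrite -[RHS]h.
by apply: eq_bigr => i _; rewrite !mxE normCKC.
Qed.

Lemma mul_unitarymx_adj n (P Q : 'M[C]_n) : P \is unitarymx -> Q \is unitarymx ->
  P *m Q^t* \is unitarymx.
Proof. by move=> Pu Qu; rewrite mul_unitarymx// trmxC_unitary. Qed.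

(** The weights are the squared overlaps between the two eigenbases; for unitary [P] and [Q] they
    form a doubly stochastic matrix. *)
Lemma tr_conjdg2 n (P Q : 'M[C]_n) (f r : 'I_n -> C) :
  \tr (conjdg Q f *m conjdg P r) =
  \sum_j \sum_i f j * (r i * `|(P *m Q^t*) i j| ^+ 2).
Proof.
set W := P *m Q^t*; have WE : W^t* = Q *m P^t* by rewrite adjmxM trmxCK.
rewrite /conjdg -!mulmxA mxtrace_mulC -!mulmxA -/W [Q *m _]mulmxA -WE.
apply: eq_bigr => j _; rewrite mul_diag_mx !mxE mulr_sumr.
apply: eq_bigr => i _; rewrite mul_diag_mx !mxE normCK; ring.
Qed.

Definition braket n (v : 'cV[C]_n) (X : 'M[C]_n) : C := (v^t* *m X *m v) 0 0.

Lemma braketD n (v : 'cV[C]_n) X Y : braket v (X + Y) = braket v X + braket v Y.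
Proof. by rewrite /braket mulmxDr mulmxDl mxE. Qed.

Lemma braketZ n (v : 'cV[C]_n) c X : braket v (c *: X) = c * braket v X.
Proof. by rewrite /braket -scalemxAr -scalemxAl mxE. Qed.

Lemma braketN n (v : 'cV[C]_n) X : braket v (- X) = - braket v X.
Proof. by rewrite /braket mulmxN mulNmx mxE. Qed.

Lemma braket1 n (v : 'cV[C]_n) : v^t* *m v = 1%:M -> braket v 1%:M = 1.
Proof. by rewrite /braket mulmx1 => ->; rewrite mxE. Qed.

Lemma braket_adjM n (v : 'cV[C]_n) (X : 'M[C]_n) :
  braket v (X^t* *m X) = \sum_i `|(X *m v) i 0| ^+ 2.
Proof.
rewrite /braket mulmxA -mulmxA -adjmxM mxE.
by apply: eq_bigr => i _; rewrite adjmxE normCKC.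
Qed.

Lemma braket_adj n (v : 'cV[C]_n) (X : 'M[C]_n) : braket v (X^t*) = (braket v X)^*.
Proof. by rewrite /braket -adjmxE !adjmxM trmxCK mulmxA. Qed.

Lemma tr_mul_pure n (v : 'cV[C]_n) (X : 'M[C]_n) : \tr (X *m (v *m v^t*)) = braket v X.
Proof. by rewrite mulmxA mxtrace_mulC mulmxA /mxtrace big_ord1. Qed.

Lemma braket_sum n (v : 'cV[C]_n) X :
  braket v X = \sum_i \sum_j (v i 0)^* * X i j * v j 0.
Proof.
rewrite /braket mxE exchange_big; apply: eq_bigr => j _.
by rewrite mxE mulr_suml; apply: eq_bigr => i _; rewrite adjmxE.
Qed.

(** Written in the basis given by [P], the outer factors only multiply the matrix elements. Both the
    evolved expectation and the commutator with the Hamiltonian have this shape. *)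
Lemma braket_conjdg_conjdg n (v : 'cV[C]_n) (X P : 'M[C]_n) (f g : 'I_n -> C) :
  braket v (conjdg P f *m X *m conjdg P g) =
  \sum_i \sum_j (((P *m v) i 0)^* * (P *m X *m P^t*) i j * (P *m v) j 0) * (f i * g j).
Proof.
have -> : braket v (conjdg P f *m X *m conjdg P g) =
    braket (P *m v) (dg f *m (P *m X *m P^t*) *m dg g).
  by rewrite /braket /conjdg adjmxM !mulmxA.
rewrite braket_sum; apply: eq_bigr => i _; apply: eq_bigr => j _.
move: (P *m X *m P^t*) (P *m v) => Y w.
by rewrite mul_mx_diag mxE mul_diag_mx !mxE; ring.
Qed.

(** The right-hand side is the squared norm of [((X - c) + i t (H - h)) v], expanded. *)
Lemma robertson_ge0 n (v : 'cV[C]_n) (X H : 'M[C]_n) (c h t : C) :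
  v^t* *m v = 1%:M -> X^t* = X -> H^t* = H -> c^* = c -> h^* = h -> t^* = t ->
  0 <=
  (braket v (X *m X) - 2 * c * braket v X + c ^+ 2) +
  t ^+ 2 * (braket v (H *m H) - 2 * h * braket v H + h ^+ 2) -
  'i * t * (braket v (H *m X) - braket v (X *m H)).
Proof.
move=> v1 Xh Hh cr hr tr.
pose M := X + ('i * t) *: H - (c + 'i * t * h)%:M.
suff <- : braket v (M^t* *m M) =
    (braket v (X *m X) - 2 * c * braket v X + c ^+ 2) +
    t ^+ 2 * (braket v (H *m H) - 2 * h * braket v H + h ^+ 2) -
    'i * t * (braket v (H *m X) - braket v (X *m H)).
  by rewrite braket_adjM sumr_ge0// => i _; rewrite exprn_ge0.
have ME : M^t* = X - ('i * t) *: H - (c - 'i * t * h)%:M.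
  apply/matrixP => i j; rewrite adjmxE !mxE !rmorphB !rmorphD !rmorphM/= rmorphMn/=.
  rewrite -!adjmxE Xh Hh conjCi eq_sym !rmorphD !rmorphM/= conjCi cr hr tr; ring.
rewrite ME /M !(mulmxDl, mulmxDr, mulNmx, mulmxN) -!scalemxAl -!scalemxAr.
rewrite !mul_scalar_mx ?mul_mx_scalar -?scalemxAl.
rewrite -[X in X%:M]mulr1 -scale_scalar_mx !(braketD, braketN, braketZ) braket1//.
have i2 : 'i ^+ 2 = -1 :> C by exact: sqrCi.
by ring: i2.
Qed.

(** Centring both observables at their expectations turns the two brackets into variances. The
    result is a quadratic in the free real parameter [t]. *)
Lemma robertson_unit_variance n (v : 'cV[C]_n) (X H : 'M[C]_n) (y t : C) :
  v^t* *m v = 1%:M -> X^t* = X -> H^t* = H -> t^* = t ->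
  braket v (H *m H) - braket v H ^+ 2 = 1 ->
  braket v (H *m X) - braket v (X *m H) = 'i * y ->
  0 <= braket v (X *m X) - braket v X ^+ 2 + t ^+ 2 + t * y.
Proof.
move=> v1 Xh Hh tr varH comm.
have cr : (braket v X)^* = braket v X by rewrite -braket_adj Xh.
have hr : (braket v H)^* = braket v H by rewrite -braket_adj Hh.
have := robertson_ge0 v1 Xh Hh cr hr tr; rewrite comm.
have -> : braket v (H *m H) = 1 + braket v H ^+ 2 by rewrite -varH subrK.
have i2 : 'i ^+ 2 = -1 :> C by exact: sqrCi.
set w := (X in 0 <= X -> _); set w' := (X in _ -> 0 <= X).
by have -> : w = w' by rewrite /w /w'; ring: i2.
Qed.

End Braket.

(** * Entropy and partial trace *)

Section Klein.
Local Open Scope complex_scope.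
Local Open Scope sesquilinear_scope.
Variable R : realType.
Local Notation C := R[i].

Lemma expectation_braket n (v : 'cV[C]_n) (X : 'M[C]_n) : Defs.expectation v X = braket v X.
Proof. by []. Qed.

Definition sqmod (z : C) : R := complex.Re z ^+ 2 + complex.Im z ^+ 2.

Lemma sqmod_ge0 z : 0 <= sqmod z.
Proof. by rewrite addr_ge0// sqr_ge0. Qed.

Lemma sqmodE z : (sqmod z)%:C = `|z| ^+ 2.
Proof. exact: add_Re2_Im2. Qed.

Lemma unitary_sqmod_row n (W : 'M[C]_n) i : W \is unitarymx ->
  \sum_j sqmod (W i j) = 1.
Proof.
move=> Wu; apply: complexI; rewrite -[RHS](unitary_row_sum i Wu) rmorph_sum/=.
by apply: eq_bigr => j _; rewrite sqmodE.
Qed.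

Lemma unitary_sqmod_col n (W : 'M[C]_n) j : W \is unitarymx ->
  \sum_i sqmod (W i j) = 1.
Proof.
move=> Wu; apply: complexI; rewrite -[RHS](unitary_col_sum j Wu) rmorph_sum/=.
by apply: eq_bigr => i _; rewrite sqmodE.
Qed.

(** For [r > 0] this is [ln z <= z - 1] at [z = s / r], multiplied by [r]. *)
Lemma gibbs_term (r s : R) : 0 <= r -> 0 < s -> r * ln s - r * ln r <= s - r.
Proof.
rewrite le_eqVlt => /orP[/eqP <-|r0] s0; first by rewrite !mul0r !subr0 ltW.
have h : ln s - ln r <= s / r - 1.
  rewrite -ln_div ?posrE// -[X in ln X](subrK 1) addrC; apply: le_ln1Dx.
  by rewrite ltrBrDr addNr divr_gt0.
have := ler_wpM2l (ltW r0) h; rewrite !mulrBr mulr1 mulrCA mulfV ?gt_eqF// mulr1.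
exact.
Qed.

(* Klein's inequality Tr rho (ln rho - ln sigma) >= Tr (rho - sigma) for
   sigma = Q^-1 diag(s) Q. *)
Lemma entropy_le_cross n (rho Q : 'M[C]_n) (s : 'I_n -> R) :
  rho \is hermsymmx -> (forall i, 0 <= eigs rho i) -> Q \is unitarymx ->
  (forall j, 0 < s j) ->
  entropy rho <= \sum_j s j - \sum_i eigs rho i
    - complex.Re (\tr (conjdg Q (fun j => (ln (s j))%:C) *m rho)).
Proof.
move=> rh r0 Qu s0; set r := eigs rho in r0 *.
(* The entries [sqmod (W i j)] have unit row and column sums. Inserting them writes every term as a
   double sum with the same weights, and [gibbs_term] applies termwise. *)
pose W := spectralmx rho *m Q^t*.
have Wu : W \is unitarymx by exact: mul_unitarymx_adj (spectral_unitarymx _) Qu.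
have -> : complex.Re (\tr (conjdg Q (fun j => (ln (s j))%:C) *m rho)) =
    \sum_i \sum_j sqmod (W i j) * (r i * ln (s j)).
  rewrite [X in _ *m X](herm_conjdg rh) tr_conjdg2 exchange_big Re_sum.
  apply: eq_bigr => i _; rewrite Re_sum; apply: eq_bigr => j _.
  by rewrite -/W -sqmodE -!rmorphM/=; ring.
rewrite entropy_eigs// -/r.
have -> : \sum_i r i = \sum_i \sum_j sqmod (W i j) * r i.
  by apply: eq_bigr => i _; rewrite -mulr_suml unitary_sqmod_row// mul1r.
have -> : \sum_i r i * ln (r i) = \sum_i \sum_j sqmod (W i j) * (r i * ln (r i)).
  by apply: eq_bigr => i _; rewrite -mulr_suml unitary_sqmod_row// mul1r.
have -> : \sum_j s j = \sum_i \sum_j sqmod (W i j) * s j.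
  by rewrite exchange_big; apply: eq_bigr => j _; rewrite -mulr_suml unitary_sqmod_col// mul1r.
rewrite -subr_ge0 opprK -!sumrB -big_split/=; apply: sumr_ge0 => i _.
rewrite -!sumrB -big_split/=; apply: sumr_ge0 => j _.
rewrite -!mulrBr -mulrDr mulr_ge0 ?sqmod_ge0//.
by have := gibbs_term (r0 i) (s0 j); lra.
Qed.

End Klein.

Section PartialTrace.
Local Open Scope complex_scope.
Local Open Scope sesquilinear_scope.
Variable R : realType.
Local Notation C := R[i].

(** Duality of the partial trace with [G |-> G (x) 1]. It turns traces against the reduced state
    into expectations in the global state. *)
Lemma tr_ptraceB dA dB (G : 'M[C]_dA) (M : 'M[C]_(dA * dB)) :
  \tr (G *m ptraceB M) = \tr (tensmx G (1%:M : 'M[C]_dB) *m M).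
Proof.
transitivity (\sum_i \sum_(j < dA) \sum_(k < dB)
    G i j * M (mxtens_index (j, k)) (mxtens_index (i, k))).
  apply: eq_bigr => i _; rewrite mxE; apply: eq_bigr => j _.
  by rewrite mxE mulr_sumr.
transitivity (\sum_(ik : ('I_dA * 'I_dB)%type)
    \sum_j G ik.1 j * M (mxtens_index (j, ik.2)) (mxtens_index (ik.1, ik.2))).
  rewrite -(pair_bigA _ (fun i k => \sum_j
    G i j * M (mxtens_index (j, k)) (mxtens_index (i, k))))/=.
  by apply: eq_bigr => i _; rewrite exchange_big.
rewrite (reindex (@mxtens_unindex dA dB)); last first.
  by exists (@mxtens_index dA dB) => x _; rewrite (mxtens_indexK, mxtens_unindexK).
apply: eq_bigr => x _; rewrite mxE.
have -> : mxtens_index ((mxtens_unindex x).1, (mxtens_unindex x).2) = x.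
  exact: mxtens_unindexK.
rewrite [RHS](reindex (@mxtens_index dA dB)); last first.
  by exists (@mxtens_unindex dA dB) => y _; rewrite (mxtens_indexK, mxtens_unindexK).
transitivity (\sum_j \sum_k
    tensmx G 1%:M x (mxtens_index (j, k)) * M (mxtens_index (j, k)) x); last first.
  by rewrite pair_bigA; apply: eq_bigr => -[].
apply: eq_bigr => j _; rewrite (bigD1 (mxtens_unindex x).2)//= big1 ?addr0.
  by rewrite !mxE mxtens_indexK/= eqxx mulr1.
by move=> k kx; rewrite !mxE mxtens_indexK/= eq_sym (negbTE kx) mulr0 mul0r.
Qed.

Lemma ptraceB_herm dA dB (v : 'cV[C]_(dA * dB)) : ptraceB (v *m v^t*) \is hermsymmx.
Proof.
apply/hermsymmxP/matrixP => i j; rewrite adjmxE !mxE rmorph_sum; apply: eq_bigr => k _.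
by rewrite !mxE !big_ord1 !mxE rmorphM/= conjCK mulrC.
Qed.

End PartialTrace.

(** * Upper bound on the rate *)

Section Trig.
Variable R : realType.
Implicit Types x y : R.

Lemma sin_mvt y : 0 < y -> exists2 c, 0 < c < y & sin y = cos c * y.
Proof.
move=> y0.
have [c] := MVT y0 (fun x _ => is_derive_sin x) (continuous_subspaceT (@continuous_sin R)).
by rewrite in_itv/= sin0 !subr0 => cy e; exists c.
Qed.

Lemma sin_norm_le y : `|sin y| <= `|y|.
Proof.
wlog y0 : y / 0 < y.
  move=> H; have [y0|y0|<-] := ltgtP 0 y; last by rewrite sin0.
    exact: H.
  by rewrite -(normrN (sin y)) -sinN -(normrN y); apply: H; rewrite oppr_gt0.
have [c _ ->] := sin_mvt y0.
by rewrite normrM ler_piMl// cos_max.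
Qed.

Lemma cos_sub1 y : cos y - 1 = - (2 * sin (y / 2) ^+ 2).
Proof.
have -> : cos y = cos ((y / 2) *+ 2) by rewrite -mulr_natr divfK ?pnatr_eq0.
by rewrite cos_mulr2n cos2sin2; ring.
Qed.

Lemma cos_sub1_norm_le_sqr y : `|cos y - 1| <= y ^+ 2.
Proof.
rewrite cos_sub1 normrN normrM normrX [`|2|]ger0_norm//.
have := sin_norm_le (y / 2); rewrite normrM [`|2^-1|]ger0_norm ?invr_ge0//.
by have := normr_ge0 (sin (y / 2)); have := normr_ge0 y; rewrite -(real_normK (num_real y)); nra.
Qed.

Lemma cos_sub1_norm_le y : `|cos y - 1| <= `|y|.
Proof.
rewrite cos_sub1 normrN normrM normrX [`|2|]ger0_norm//.
have := sin_norm_le (y / 2); rewrite normrM [`|2^-1|]ger0_norm ?invr_ge0//.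
by have := normr_ge0 (sin (y / 2)); have := sin_max (y / 2); nra.
Qed.

(** For [y > 0] the mean value theorem gives [sin y - y = (cos c - 1) y] with [0 < c < y]. The cubic
    order is not sharp here: a quadratic remainder is enough for a first derivative. *)
Lemma sin_sub_norm_le_sqr y : `|sin y - y| <= y ^+ 2.
Proof.
wlog y0 : y / 0 < y.
  move=> H; have [y0|y0|<-] := ltgtP 0 y; last by rewrite sin0 subr0 normr0 expr0n.
    exact: H.
  by rewrite -normrN opprD -sinN -[y ^+ 2]sqrrN; apply: H; rewrite oppr_gt0.
have [c /andP[c0 cy] ->] := sin_mvt y0.
have -> : cos c * y - y = (cos c - 1) * y by ring.
rewrite normrM (gtr0_norm y0) expr2 ler_wpM2r ?(ltW y0)//.
by apply: le_trans (cos_sub1_norm_le c) _; rewrite gtr0_norm// ltW.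
Qed.

(* One-sided: where f is not derivable at 0, derive1 takes the value 0. *)
Lemma derive1_0_le (f : R -> R) (a b k m : R) : 0 <= m -> a <= m ->
  (forall t, 0 < t < 1 -> f t <= f 0 + t * (a + b * t - k * xlnx t)) ->
  derive1 f 0 <= m.
Proof.
move=> m0 am hf; rewrite /derive1.
set g := fun h => h^-1 *: (f (h + 0) - f 0).
have [cg|ncg] := pselect (cvg (g @ 0^')); last by rewrite dvgP.
rewrite cvg_at_rightE//; apply: le_trans am.
have cgr : cvg (g @ 0^'+).
  apply: (cvgP (lim (g @ 0^'))); apply: cvg_trans cg; apply: cvg_app.
  by move=> A [e e0 Ae]; exists e => // x xe x0; apply: Ae => //; exact: lt0r_neq0.
(* The bound on the difference quotient tends to [a] from the right, because [xlnx] is continuous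
   with value [0] at [0]. *)
apply: (@ler_cvg_to _ ((0 : R)^'+) _ _ g (fun t => a + b * t - k * xlnx t)) => //.
  suff h : a + b * t - k * xlnx t @[t --> (0 : R)] --> a.
    exact: cvg_at_right_filter h.
  rewrite [X in _ --> X](_ : a = a + b * 0 - k * xlnx 0); last first.
    by rewrite /xlnx mul0r !mulr0 addr0 subr0.
  apply: cvgB; last by apply: cvgM; [exact: cvg_cst|exact: continuous_xlnx].
  apply: cvgD; first exact: cvg_cst.
  by apply: cvgM; [exact: cvg_cst|exact: cvg_id].
near=> t.
have t0 : 0 < t by near: t; exact: nbhs_right_gt.
have t1 : t < 1 by near: t; exact: nbhs_right_lt.
rewrite /g /GRing.scale/= addr0 mulrC ler_pdivrMr// mulrC lerBlDl.
by apply: hf; rewrite t0.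
Unshelve. all: by end_near. Qed.

End Trig.

(** * Observables of the first system and commutators *)

Section Observables.
Local Open Scope sesquilinear_scope.
Variable C : numClosedFieldType.

Lemma mul_pure_adj n (A : 'M[C]_n) (v : 'cV[C]_n) :
  A *m (v *m v^t*) *m A^t* = (A *m v) *m (A *m v)^t*.
Proof. by rewrite adjmxM !mulmxA. Qed.

Lemma braket_mulmx n (A : 'M[C]_n) (v : 'cV[C]_n) (X : 'M[C]_n) :
  braket (A *m v) X = braket v (A^t* *m X *m A).
Proof. by rewrite /braket adjmxM !mulmxA. Qed.

Lemma conjdg_lin n (Q : 'M[C]_n) (f g : 'I_n -> C) (c : C) :
  conjdg Q (fun i => f i + c * g i) = conjdg Q f + c *: conjdg Q g.
Proof.
rewrite /conjdg scalemxAl scalemxAr -mulmxDl -mulmxDr; congr (_ *m _ *m _).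
apply/matrixP => i j; rewrite !mxE.
by case: (i == j); rewrite ?mulr1n ?mulr0n ?mulr0 ?addr0.
Qed.

Lemma tensmx11 m n : tensmx (1%:M : 'M[C]_m) (1%:M : 'M[C]_n) = 1%:M.
Proof.
apply/matrixP => i j; case: (mxtens_indexP i) => i1 i2; case: (mxtens_indexP j) => j1 j2.
rewrite tensmxE !mxE (can_eq (@mxtens_indexK m n)) xpair_eqE.
by case: eqP; case: eqP => _ _; rewrite ?mulr1n ?mulr0n ?mul0r ?mulr0 ?mul1r.
Qed.

Lemma tensmx_adj m n p q (A : 'M[C]_(m, n)) (B : 'M[C]_(p, q)) :
  (tensmx A B)^t* = tensmx (A^t*) (B^t*).
Proof. by rewrite trmx_tens map_mxT. Qed.

Lemma adjmx1 n : (1%:M : 'M[C]_n)^t* = 1%:M.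
Proof. by rewrite trmx1 map_mx1. Qed.

Definition obs dA dB (Q : 'M[C]_dA) (f : 'I_dA -> C) : 'M[C]_(dA * dB) :=
  tensmx (conjdg Q f) 1%:M.

Lemma obsM dA dB (Q : 'M[C]_dA) (f g : 'I_dA -> C) : Q \is unitarymx ->
  obs dB Q f *m obs dB Q g = obs dB Q (fun i => f i * g i).
Proof. by move=> Qu; rewrite /obs tensmx_mul conjdgM// mulmx1. Qed.

Lemma obs_adj dA dB (Q : 'M[C]_dA) (f : 'I_dA -> C) :
  (obs dB Q f)^t* = obs dB Q (fun i => (f i)^*).
Proof. by rewrite /obs tensmx_adj conjdg_adj adjmx1. Qed.

Lemma unitary_pure n (U : 'M[C]_n) (v : 'cV[C]_n) : U \is unitarymx ->
  v^t* *m v = 1%:M -> (U *m v)^t* *m (U *m v) = 1%:M.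
Proof.
move=> Uu v1; rewrite adjmxM -mulmxA [U^t* *m _]mulmxA unitarymxK// mul1mx.
exact: v1.
Qed.

Lemma conjdg_unitary n (P : 'M[C]_n) (f : 'I_n -> C) : P \is unitarymx ->
  (forall i, f i * (f i)^* = 1) -> conjdg P f \is unitarymx.
Proof.
move=> Pu f1; apply/unitarymxP; rewrite conjdg_adj conjdgM//.
by rewrite (_ : (fun i => _) = fun=> 1) ?conjdg1//; apply/funext.
Qed.

(** Inserting the identity as [conjdg P] of the constant [1] brings both products to the form of
    [braket_conjdg_conjdg]. *)
Lemma braket_comm_conjdg n (v : 'cV[C]_n) (X P : 'M[C]_n) (h : 'I_n -> C) :
  P \is unitarymx ->
  braket v (conjdg P h *m X) - braket v (X *m conjdg P h) =
  \sum_i \sum_j (((P *m v) i 0)^* * (P *m X *m P^t*) i j * (P *m v) j 0) * (h i - h j).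
Proof.
move=> Pu.
rewrite -[conjdg P h *m X]mulmx1 -{2}[X]mul1mx -(conjdg1 Pu) !braket_conjdg_conjdg.
rewrite -sumrB; apply: eq_bigr => i _; rewrite -sumrB; apply: eq_bigr => j _.
by rewrite mulr1 mul1r mulrBr.
Qed.

Lemma braket_conjdg_mulmx n (v : 'cV[C]_n) (X P : 'M[C]_n) (e : 'I_n -> C) :
  braket (conjdg P e *m v) X =
  \sum_i \sum_j (((P *m v) i 0)^* * (P *m X *m P^t*) i j * (P *m v) j 0) *
    ((e i)^* * e j).
Proof. by rewrite braket_mulmx conjdg_adj braket_conjdg_conjdg. Qed.

(** The second moment of [Y] is the squared norm of [Y *m v], so [Y] kills [v] on both sides.
    Applied to the kernel projector of the reduced state, this removes the first-order growth of the
    weight on that kernel. *)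
Lemma braket_comm_null n (v : 'cV[C]_n) (H Y : 'M[C]_n) :
  Y^t* = Y -> braket v (Y *m Y) = 0 ->
  braket v (H *m Y) - braket v (Y *m H) = 0.
Proof.
move=> Yh; rewrite -{1}Yh braket_adjM => /eqP.
rewrite psumr_eq0 => [/allP Y0|i _]; last by rewrite exprn_ge0.
have Yv : Y *m v = 0.
  apply/matrixP => i j; rewrite ord1 [RHS]mxE; apply/eqP.
  by have := Y0 i (mem_index_enum i); rewrite /= sqrf_eq0 normr_eq0.
have vY : v^t* *m Y = 0 by rewrite -Yh -adjmxM Yv trmx0 map_mx0.
by rewrite /braket -!mulmxA Yv !mulmx0 [_ *m (_ *m (H *m v))]mulmxA vY mul0mx subrr.
Qed.

Lemma braket_obs1 dA dB (Q : 'M[C]_dA) (v : 'cV[C]_(dA * dB)) : Q \is unitarymx ->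
  v^t* *m v = 1%:M -> braket v (obs dB Q (fun=> 1)) = 1.
Proof. by move=> Qu v1; rewrite /obs conjdg1// tensmx11 braket1. Qed.

Lemma braket_obs_lin dA dB (Q : 'M[C]_dA) (v : 'cV[C]_(dA * dB)) f g c :
  braket v (obs dB Q (fun i => f i + c * g i)) =
  braket v (obs dB Q f) + c * braket v (obs dB Q g).
Proof.
rewrite -braketZ -braketD; congr (braket v _); rewrite /obs conjdg_lin.
by apply/matrixP => i j; rewrite !mxE; ring.
Qed.

(** The observable is an orthogonal projector. This yields nonnegativity of the eigenvalues of the
    reduced state. *)
Lemma braket_obs_ge0 dA dB (Q : 'M[C]_dA) (v : 'cV[C]_(dA * dB)) i : Q \is unitarymx ->
  0 <= braket v (obs dB Q (fun j => (j == i)%:R)).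
Proof.
move=> Qu.
have -> : obs dB Q (fun j => (j == i)%:R) =
    (obs dB Q (fun j => (j == i)%:R))^t* *m obs dB Q (fun j => (j == i)%:R).
  rewrite obs_adj obsM//; congr (obs dB Q _); apply/funext => j.
  by rewrite conjC_nat; case: (j == i); rewrite ?mulr1 ?mulr0.
by rewrite braket_adjM sumr_ge0// => k _; rewrite exprn_ge0.
Qed.

End Observables.

(** * Time evolution of expectations *)

Section UpperBound.
Local Open Scope complex_scope.
Local Open Scope sesquilinear_scope.
Variable R : realType.
Local Notation C := R[i].

(** This is [e^(-i x)], with the sign of the evolution operator. *)
Definition cis (x : R) : C := cos x -i* sin x.

Lemma conj_cisM x y : ((cis x)^*)%R * cis y = cos (x - y) +i* sin (x - y).
Proof.
rewrite cosB sinB /cis; change ((cos x -i* sin x)^*)%R with (cos x +i* (- - sin x)).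
by rewrite opprK; apply/eqP; rewrite eq_complex/=; apply/andP; split; apply/eqP; ring.
Qed.

Lemma conj_cis x : ((cis x)^*)%R = cis (- x).
Proof. by rewrite /cis cosN sinN. Qed.

Lemma evolution_conjdg n (H : 'M[C]_n) t :
  evolution H t = conjdg (spectralmx H) (fun i => cis (t * eigs H i)).
Proof. exact: hermfun_conjdg. Qed.

Lemma evolution_adj n (H : 'M[C]_n) t : (evolution H t)^t* = evolution H (- t).
Proof.
rewrite !evolution_conjdg conjdg_adj.
suff -> : (fun i => ((cis (t * eigs H i))^*)%R) = (fun i => cis (- t * eigs H i)) by [].
by apply/funext => i; rewrite conj_cis mulNr.
Qed.

Lemma evolution_unitary n (H : 'M[C]_n) t : evolution H t \is unitarymx.
Proof.
rewrite evolution_conjdg; apply: conjdg_unitary; first exact: spectral_unitarymx.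
by move=> i; rewrite mulrC conj_cisM subrr cos0 sin0.
Qed.

Lemma evolution0 n (H : 'M[C]_n) : evolution H 0 = 1%:M.
Proof.
rewrite evolution_conjdg -(conjdg1 (spectral_unitarymx H)).
suff -> : (fun i => cis (0 * eigs H i)) = fun=> 1 by [].
by apply/funext => i; rewrite mul0r /cis cos0 sin0 oppr0.
Qed.

Lemma evolve_pure n (H : 'M[C]_n) (v : 'cV[C]_n) t :
  evolution H t *m (v *m v^t*) *m evolution H (- t) =
  (evolution H t *m v) *m (evolution H t *m v)^t*.
Proof. by rewrite -evolution_adj mul_pure_adj. Qed.

(** In the eigenbasis of [H] the evolved expectation is a finite sum of terms
    [z i j * e^(i t (h i - h j))]. The quadratic remainders of [cos] and [sin] give [K], and the
    first-order term is the expectation of [i [H, X]], whose real part is minus the imaginary part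
    of that of [[H, X]]. *)
Lemma braket_evolution_taylor n (H X : 'M[C]_n) (v : 'cV[C]_n) : H \is hermsymmx ->
  exists2 K : R, 0 <= K & forall t : R,
    `|complex.Re (braket (evolution H t *m v) X) - complex.Re (braket v X)
      + t * complex.Im (braket v (H *m X) - braket v (X *m H))| <= K * t ^+ 2.
Proof.
move=> Hh; set P := spectralmx H; set h := eigs H.
pose z i j : C := (((P *m v) i 0)^*)%R * (P *m X *m P^t*) i j * (P *m v) j 0.
have eU t : complex.Re (braket (evolution H t *m v) X) = \sum_i \sum_j
    (complex.Re (z i j) * cos (t * (h i - h j)) - complex.Im (z i j) * sin (t * (h i - h j))).
  rewrite evolution_conjdg braket_conjdg_mulmx Re_sum; apply: eq_bigr => i _.
  rewrite Re_sum; apply: eq_bigr => j _; rewrite -/P -/h -/(z i j) conj_cisM mulrBr.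
  by case: (z i j).
have e0 : complex.Re (braket v X) = \sum_i \sum_j complex.Re (z i j).
  have := eU 0; rewrite evolution0 mul1mx => ->; apply: eq_bigr => i _.
  by apply: eq_bigr => j _; rewrite mul0r cos0 sin0 mulr1 mulr0 subr0.
have eH : complex.Im (braket v (H *m X) - braket v (X *m H)) =
    \sum_i \sum_j complex.Im (z i j) * (h i - h j).
  have := braket_comm_conjdg v X (fun i => (h i)%:C) (spectral_unitarymx H).
  rewrite -(herm_conjdg Hh) => ->; rewrite Im_sum; apply: eq_bigr => i _.
  rewrite Im_sum; apply: eq_bigr => j _; rewrite -/P -/(z i j) -rmorphB/=.
  by case: (z i j) => a b /=; rewrite mulr0 add0r.
exists (\sum_i \sum_j (`|complex.Re (z i j)| + `|complex.Im (z i j)|) * (h i - h j) ^+ 2).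
  by apply: sumr_ge0 => i _; apply: sumr_ge0 => j _; rewrite mulr_ge0 ?sqr_ge0 ?addr_ge0.
move=> t; rewrite eU e0 eH mulr_sumr mulr_suml -sumrB -big_split/=.
apply: le_trans (ler_norm_sum _ _ _) _; apply: ler_sum => i _.
rewrite mulr_sumr mulr_suml -sumrB -big_split/=.
apply: le_trans (ler_norm_sum _ _ _) _; apply: ler_sum => j _.
set y := h i - h j; set a := complex.Re _; set b := complex.Im _.
have -> : a * cos (t * y) - b * sin (t * y) - a + t * (b * y) =
   a * (cos (t * y) - 1) - b * (sin (t * y) - t * y) by ring.
apply: le_trans (ler_normB _ _) _; rewrite !normrM -mulrA -exprMn [y * t]mulrC mulrDl.
by rewrite lerD// ler_wpM2l// ?cos_sub1_norm_le_sqr// sin_sub_norm_le_sqr.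
Qed.

Lemma braket_herm n (v : 'cV[C]_n) (X : 'M[C]_n) : X^t* = X ->
  braket v X = (complex.Re (braket v X))%:C.
Proof.
move=> Xh; have : ((braket v X)^*)%R = braket v X by rewrite -braket_adj Xh.
by move=> /CrealP/RRe_real.
Qed.

Lemma conj_opp_imag (z : C) : (z^*)%R = - z -> z = 'i%C * (complex.Im z)%:C.
Proof.
case: z => a b [/eqP]; rewrite -subr_eq0 opprK -mulr2n mulrn_eq0/= => /eqP ->.
by apply/eqP; rewrite eq_complex/=; apply/andP; split; apply/eqP; ring.
Qed.

Lemma robertson n (v : 'cV[C]_n) (X H : 'M[C]_n) :
  v^t* *m v = 1%:M -> X^t* = X -> H^t* = H ->
  braket v (H *m H) - braket v H ^+ 2 = 1 ->
  complex.Im (braket v (H *m X) - braket v (X *m H)) ^+ 2 <=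
  4 * (complex.Re (braket v (X *m X)) - complex.Re (braket v X) ^+ 2).
Proof.
move=> v1 Xh Hh varH; set z := _ - _; set y := complex.Im z.
have zE : z = 'i%R * y%:C.
  rewrite -complexiE; apply: conj_opp_imag.
  by rewrite /z rmorphB/= -!braket_adj !adjmxM Xh Hh opprB.
have XXh : (X *m X)^t* = X *m X by rewrite adjmxM Xh.
(* The value [t = - y / 2] minimizes [t^2 + t y] and leaves [- y^2 / 4]. *)
have := robertson_unit_variance v1 Xh Hh (conjC_real (- y / 2)) varH zE.
rewrite (braket_herm v XXh) (braket_herm v Xh).
rewrite -!rmorphXn -!rmorphM -rmorphB -!rmorphD ler0c/=.
move: (complex.Re _) (complex.Re _) y {zE} => A c y; lra.
Qed.

End UpperBound.

Lemma le_2sqrt (R : realType) (x V : R) : x ^+ 2 <= 4 * V -> x <= 2 * Num.sqrt V.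
Proof.
move=> hx; have V0 : 0 <= V by have := sqr_ge0 x; lra.
have sV := sqr_sqrtr V0; have s0 := sqrtr_ge0 V.
by rewrite -sV in hx; rewrite leNgt; apply/negP => hlt; nra.
Qed.

(** Arithmetic for [Gamma_le]: [a] and [a0] stand for the expectation of [X] at times [t] and [0],
    [b] for that of [Y] at time [t], and [l] for [ln t]. Since [l < 0], an upper bound on [b] is one
    on [- l * b]. *)
Lemma entropy_increment_le (R : realType) (t l a b a0 x K L k : R) : l < 0 ->
  - (K * t ^+ 2) <= a - a0 + t * x -> b <= L * t ^+ 2 ->
  1 + k * t ^+ 2 - 1 - (a + l *+ 2 * b) <=
  - a0 + t * (x + (K + k) * t - 2 * L * (t * l)).
Proof.
move=> l0 ha hb; have h : - l * b <= - l * (L * t ^+ 2).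
  by rewrite ler_wpM2l// oppr_ge0 ltW.
by rewrite mulr2n; lra.
Qed.

(** * Reduced states and the bound on the rate *)

Section Reduced.
Local Open Scope complex_scope.
Local Open Scope sesquilinear_scope.
Variable R : realType.
Local Notation C := R[i].
Variables (dA dB : nat).
Implicit Types v : 'cV[C]_(dA * dB).

Definition reduced v : 'M[C]_dA := ptraceB (v *m v^t*).

Lemma tr_mul_reduced (Q : 'M[C]_dA) (f : 'I_dA -> C) v :
  \tr (conjdg Q f *m reduced v) = braket v (obs dB Q f).
Proof. by rewrite /reduced tr_ptraceB tr_mul_pure. Qed.

(** Measuring the first system in the eigenbasis of its reduced state gives outcome [i] with
    probability the [i]-th eigenvalue. *)
Lemma braket_obs_eigs v (f : 'I_dA -> C) :
  braket v (obs dB (spectralmx (reduced v)) f) = \sum_i f i * (eigs (reduced v) i)%:C.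
Proof.
rewrite -tr_mul_reduced [X in _ *m X](herm_conjdg (ptraceB_herm v)).
by rewrite conjdgM ?spectral_unitarymx// tr_conjdg// spectral_unitarymx.
Qed.

Lemma eigs_reduced_ge0 v i : 0 <= eigs (reduced v) i.
Proof.
have := braket_obs_ge0 v i (spectral_unitarymx (reduced v)).
rewrite braket_obs_eigs (bigD1 i)//= eqxx mul1r big1 ?addr0 ?ler0c//.
by move=> j /negbTE ->; rewrite mul0r.
Qed.

Lemma sum_eigs_reduced v : v^t* *m v = 1%:M -> \sum_i eigs (reduced v) i = 1.
Proof.
move=> v1; apply: complexI.
rewrite -[RHS](braket_obs1 (spectral_unitarymx (reduced v)) v1) braket_obs_eigs.
by rewrite rmorph_sum/=; apply: eq_bigr => i _; rewrite mul1r.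
Qed.

Lemma entropy_reduced v :
  entropy (reduced v) = - \sum_i eigs (reduced v) i * ln (eigs (reduced v) i).
Proof. by rewrite entropy_eigs// ptraceB_herm. Qed.

Lemma entropy_reduced_le v (Q : 'M[C]_dA) (s : 'I_dA -> R) :
  v^t* *m v = 1%:M -> Q \is unitarymx -> (forall j, 0 < s j) ->
  entropy (reduced v) <=
  \sum_j s j - 1 - complex.Re (braket v (obs dB Q (fun j => (ln (s j))%:C))).
Proof.
move=> v1 Qu s0; rewrite -(sum_eigs_reduced v1) -tr_mul_reduced.
by apply: entropy_le_cross => //; [exact: ptraceB_herm|exact: eigs_reduced_ge0].
Qed.

Lemma Gamma_le v (H : 'M[C]_(dA * dB)) : admissible v H ->
  exists2 p : 'I_dA -> R, prob_dist p &
    Gamma v H <= 2 * Num.sqrt (surprisal_variance p).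
Proof.
move=> [v1 Hh varH]; set p := eigs (reduced v).
have p0 i : 0 <= p i by exact: eigs_reduced_ge0.
have p1 : \sum_i p i = 1 by exact: sum_eigs_reduced.
exists p => //.
set Q := spectralmx (reduced v).
have Qu : Q \is unitarymx by exact: spectral_unitarymx.
(* [X] is [ln rho (x) 1], set to [0] on the kernel of [rho] by [ln 0 = 0], and [Y] is the projector
   on that kernel. *)
pose f j : C := (ln (p j))%:C; pose g j : C := (p j == 0)%:R.
pose X := obs dB Q f; pose Y := obs dB Q g.
have Xh : X^t* = X.
  rewrite /X obs_adj; congr (obs dB Q _); apply/funext => j; exact: conjC_real.
have Yh : Y^t* = Y.
  rewrite /Y obs_adj; congr (obs dB Q _); apply/funext => j; exact: conjC_nat.
have eX : complex.Re (braket v X) = \sum_i p i * ln (p i).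
  rewrite /X braket_obs_eigs Re_sum; apply: eq_bigr => i _.
  by rewrite /f Re_realM/= mulrC.
have eXX : complex.Re (braket v (X *m X)) = \sum_i p i * ln (p i) ^+ 2.
  rewrite /X (obsM _ _ _ Qu) braket_obs_eigs Re_sum; apply: eq_bigr => i _.
  by rewrite /f -rmorphM Re_realM/= mulrC expr2.
have gp i : g i * (p i)%:C = 0.
  by rewrite /g; have [->|_] := eqVneq (p i) 0; rewrite ?mulr0 ?mul0r.
have ggp i : g i * g i * (p i)%:C = 0.
  by rewrite /g; have [->|_] := eqVneq (p i) 0; rewrite ?mulr0 ?mul0r.
have eY : braket v Y = 0.
  by rewrite /Y braket_obs_eigs; apply: big1 => i _; exact: gp.
have eYY : braket v (Y *m Y) = 0.
  by rewrite /Y (obsM _ _ _ Qu) braket_obs_eigs; apply: big1 => i _; exact: ggp.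
have Hadj : H^t* = H by exact/hermsymmxP.
have [K K0 hK] := braket_evolution_taylor X v Hh.
have [L L0 hL] := braket_evolution_taylor Y v Hh.
have cY := braket_comm_null H Yh eYY.
(* [x] is minus the derivative at [0] of the expectation of [X]; the initial entropy is minus that
   expectation. *)
set x := complex.Im _ in hK.
have xV : x <= 2 * Num.sqrt (surprisal_variance p).
  have := robertson v1 Xh Hadj varH; rewrite -/x eX eXX -/(surprisal_variance p) => hx.
  exact: le_2sqrt hx.
rewrite /Gamma.
pose w t := evolution H t *m v.
have -> : (fun t => entanglement (evolution H t *m (v *m v^t*) *m evolution H (- t)))
    = fun t => entropy (reduced (w t)).
  by apply/funext => t; rewrite /entanglement evolve_pure.
pose k : R := \sum_j (p j == 0)%:R.
(* The remainder of [X] contributes [K t^2] and the excess trace of the comparison matrix [k t^2].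
   The kernel weight, at most [L t^2], is multiplied by [- ln (t^2)], hence the coefficient [2 L] of
   [t ln t]. *)
apply: (@derive1_0_le _ _ x (K + k) (2 * L)) => //.
move=> t /andP[t0 t1].
have w0 : w 0 = v by rewrite /w evolution0 mul1mx.
rewrite w0 (entropy_reduced v) -/p -eX.
(* The evolved state has weight O(t^2) on the kernel of the initial one. *)
pose s j := if p j == 0 then t ^+ 2 else p j.
have s0 j : 0 < s j.
  by rewrite /s; case: ifPn => [_|pj]; [rewrite exprn_gt0|rewrite lt_neqAle eq_sym pj p0].
have wt1 : (w t)^t* *m w t = 1%:M by apply: unitary_pure => //; exact: evolution_unitary.
apply: le_trans (entropy_reduced_le wt1 Qu s0) _.
have -> : \sum_j s j = 1 + k * t ^+ 2.
  rewrite -p1 /k mulr_suml -big_split/=; apply: eq_bigr => j _; rewrite /s.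
  by have [->|_] := eqVneq (p j) 0; rewrite ?add0r ?mul1r ?mul0r ?addr0.
have -> : (fun j => (ln (s j))%:C) = (fun j => f j + (ln (t ^+ 2))%:C * g j).
  apply/funext => j; rewrite /f /g /s; have [->|_] := eqVneq (p j) 0.
    by rewrite (@ln0 R 0)// rmorph0 add0r mulr1.
  by rewrite mulr0 addr0.
rewrite braket_obs_lin -/X -/Y.
have ReD (a b : C) : complex.Re (a + b) = complex.Re a + complex.Re b by case: a b => [? ?] [? ?].
rewrite ReD Re_realM lnXn//.
have lt0 : ln t < 0 by rewrite ln_lt0 ?t0.
have hX : - (K * t ^+ 2) <= complex.Re (braket (w t) X) - complex.Re (braket v X) + t * x.
  by have := hK t; rewrite ler_norml => /andP[].
have hY : complex.Re (braket (w t) Y) <= L * t ^+ 2.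
  have := hL t; rewrite eY cY subr0 mulr0 addr0.
  exact: le_trans (ler_norm _).
by apply: entropy_increment_le.
Qed.

End Reduced.

(** * The optimal state and Hamiltonian *)

Section TwoLevel.
Local Open Scope sesquilinear_scope.
Variable C : numClosedFieldType.

Lemma conjdg_inj n (P : 'M[C]_n) (f g : 'I_n -> C) : P \is unitarymx ->
  conjdg P f = conjdg P g -> f =1 g.
Proof.
move=> Pu e i.
have dgE f' : P *m conjdg P f' *m P^t* = dg f'.
  rewrite /conjdg !mulmxA (unitarymxP Pu) mul1mx -mulmxA (unitarymxP Pu).
  by rewrite mulmx1.
have : dg f i i = dg g i i by rewrite -!dgE e.
by rewrite !mxE eqxx !mulr1n.
Qed.

(* The diagonal matrix may be diagonalized by a matrix P other than the
   identity, but P only mixes basis vectors with the same eigenvalue. *)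
Lemma conjdg_dg_fun n (P : 'M[C]_n) (d e f g : 'I_n -> C) : P \is unitarymx ->
  dg d = conjdg P e -> (forall i j, d j = e i -> g j = f i) ->
  conjdg P f = dg g.
Proof.
move=> Pu dP fg.
have Pd : P *m dg d = dg e *m P.
  by rewrite dP /conjdg !mulmxA (unitarymxP Pu) mul1mx.
have Pg : dg f *m P = P *m dg g.
  apply/matrixP => i j; move/matrixP/(_ i j): Pd.
  rewrite /dg !mul_mx_diag !mul_diag_mx !mxE.
  move=> Pde; have [/fg ->|dej] := eqVneq (d j) (e i); first by rewrite mulrC.
  move/eqP: Pde; rewrite [P i j * d j]mulrC -subr_eq0 -mulrBl mulf_eq0 subr_eq0 (negbTE dej)/=.
  by move=> /eqP ->; rewrite mulr0 mul0r.
by rewrite /conjdg -mulmxA Pg mulmxA unitarymxK// mul1mx.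
Qed.

Lemma adjmx_comb m n (a b : C) (A B : 'M[C]_(m, n)) :
  (a *: A + b *: B)^t* = a^* *: A^t* + b^* *: B^t*.
Proof. by apply/matrixP => i j; rewrite !mxE rmorphD !rmorphM. Qed.

Lemma adjmxZ m n (a : C) (A : 'M[C]_(m, n)) : (a *: A)^t* = a^* *: A^t*.
Proof. by apply/matrixP => i j; rewrite !mxE rmorphM. Qed.

Lemma conjdg_cube n (P A : 'M[C]_n) (h : 'I_n -> C) : P \is unitarymx ->
  A = conjdg P h -> A *m (A *m A) = A -> forall i, h i * (h i * h i) = h i.
Proof.
move=> Pu AE A3; apply: (conjdg_inj (f := fun i => h i * (h i * h i)) Pu).
by rewrite -!conjdgM// -AE.
Qed.

Lemma conjdg_quadratic n (P A : 'M[C]_n) (h e : 'I_n -> C) (a b : C) :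
  P \is unitarymx -> A = conjdg P h ->
  (forall i, e i = 1 + a * h i + b * (h i * h i)) ->
  conjdg P e = 1%:M + a *: A + b *: (A *m A).
Proof.
move=> Pu -> eE; rewrite conjdgM// -(conjdg1 Pu) -!conjdg_lin.
by congr (conjdg P _); apply/funext => i; rewrite eE.
Qed.

(** For orthonormal [u] and [f] this is minus the Pauli matrix [sigma_y] on their span and zero on
    the orthogonal complement. *)
Definition two_level_ham n (u f : 'cV[C]_n) : 'M[C]_n := 'i *: (u *m f^t* - f *m u^t*).

Variables (n : nat) (u f : 'cV[C]_n).
Hypotheses (uu : u^t* *m u = 1%:M) (ff : f^t* *m f = 1%:M) (uf : u^t* *m f = 0).

Local Notation K := (two_level_ham u f).

Let fu : f^t* *m u = 0.
Proof. by rewrite -[u]trmxCK -adjmxM uf trmx0 map_mx0. Qed.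

Lemma rot_adj : K^t* = K.
Proof.
have e : (u *m f^t* - f *m u^t*)^t* = f *m u^t* - u *m f^t*.
  by rewrite linearB/= map_mxB !adjmxM !trmxCK.
have -> : K^t* = ('i)^* *: (u *m f^t* - f *m u^t*)^t*.
  by rewrite /two_level_ham linearZ/= map_mxZ.
by rewrite e conjCi scaleNr -scalerN opprB.
Qed.

Lemma rot_lin (a b : C) : K *m (a *: u + b *: f) = 'i *: (b *: u - a *: f).
Proof.
rewrite /two_level_ham -scalemxAl mulmxBl !mulmxDr -!scalemxAr -!mulmxA uu ff uf fu.
by rewrite !mulmx0 !mulmx1 !scaler0 add0r addr0.
Qed.

Lemma rot_rot_lin (a b : C) : K *m (K *m (a *: u + b *: f)) = a *: u + b *: f.
Proof.
rewrite rot_lin -scaleNr -scalemxAr rot_lin scalerA -expr2 sqrCi scaleN1r.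
by rewrite opprB scaleNr opprK addrC.
Qed.

(** [K *m K] fixes [u] and [f], whose span contains the range of [K]. *)
Lemma rot3 : K *m (K *m K) = K.
Proof.
have r1 : K *m u = - 'i *: f.
  by have := rot_lin 1 0; rewrite !scale1r !scale0r addr0 sub0r scalerN scaleNr.
have r2 : K *m f = 'i *: u.
  by have := rot_lin 0 1; rewrite !scale1r !scale0r add0r subr0.
have rr1 : K *m (K *m u) = u.
  by have := rot_rot_lin 1 0; rewrite !scale1r !scale0r addr0.
have rr2 : K *m (K *m f) = f.
  by have := rot_rot_lin 0 1; rewrite !scale1r !scale0r add0r.
by rewrite {3 4}/two_level_ham -!scalemxAr !mulmxBr !mulmxA -[K *m K *m u]mulmxA
  -[K *m K *m f]mulmxA rr1 rr2.
Qed.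

Lemma pure_comb (a b : C) : a^* = a -> b^* = b -> a ^+ 2 + b ^+ 2 = 1 ->
  (a *: u + b *: f)^t* *m (a *: u + b *: f) = 1%:M.
Proof.
move=> ar br ab; rewrite adjmx_comb ar br mulmxDl !mulmxDr.
rewrite -!scalemxAl -!scalemxAr uu ff uf fu !scaler0 addr0 add0r.
by rewrite !scalerA -scalerDl -!expr2 ab scale1r.
Qed.

Lemma braket_rot (a b : C) : a^* = a -> b^* = b ->
  braket (a *: u + b *: f) K = 0.
Proof.
move=> ar br; rewrite /braket -mulmxA rot_lin adjmx_comb ar br.
rewrite -scalemxAr mulmxDl !mulmxBr -!scalemxAl -!scalemxAr uu ff uf fu !scaler0.
by rewrite subr0 sub0r !scalerA [b * a]mulrC subrr scaler0 mxE.
Qed.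

Lemma braket_rot2 (a b : C) : a^* = a -> b^* = b -> a ^+ 2 + b ^+ 2 = 1 ->
  braket (a *: u + b *: f) (K *m K) = 1.
Proof.
move=> ar br ab; rewrite /braket -!mulmxA rot_rot_lin pure_comb//.
by rewrite mxE.
Qed.

Lemma rotZ_adj (s : C) : s^* = s -> (s *: K)^t* = s *: K.
Proof. by move=> sr; rewrite adjmxZ rot_adj sr. Qed.

Lemma rotZ_sqr (s : C) : s ^+ 2 = 1 -> (s *: K) *m (s *: K) = K *m K.
Proof.
move: K => A s2.
by rewrite -scalemxAl -scalemxAr scalerA -expr2 s2 scale1r.
Qed.

Lemma rotZ3 (s : C) : s ^+ 2 = 1 ->
  (s *: K) *m ((s *: K) *m (s *: K)) = s *: K.
Proof.
by move=> s2; rewrite rotZ_sqr//; have := rot3; move: K => A A3; rewrite -scalemxAl A3.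
Qed.

(** At [p = sin t] and [q = cos t] the first factor is [e^(-i t s K)], and the result is a rotation
    in the plane of [u] and [f] with orientation [s]. *)
Lemma rotZ_evolve (s a b p q : C) : s ^+ 2 = 1 ->
  (1%:M + (- 'i * p) *: (s *: K) + (q - 1) *: ((s *: K) *m (s *: K))) *m
    (a *: u + b *: f) =
  (a * q + s * b * p) *: u + (b * q - s * a * p) *: f.
Proof.
move=> s2; rewrite rotZ_sqr//; have := rot_rot_lin a b; have := rot_lin a b.
move: K => A Av AAv; rewrite !mulmxDl mul1mx -!scalemxAl -mulmxA AAv Av.
have i2 : 'i ^+ 2 = -1 :> C by exact: sqrCi.
by apply/matrixP => i j; rewrite !mxE; ring: i2.
Qed.

End TwoLevel.

(** * Vectors in Schmidt form *)

Section Diagonal.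
Local Open Scope sesquilinear_scope.
Variable C : numClosedFieldType.

Lemma sum_mxtens dA dB (F : 'I_(dA * dB) -> C) :
  \sum_x F x = \sum_(i < dA) \sum_(k < dB) F (mxtens_index (i, k)).
Proof.
rewrite pair_bigA (reindex (@mxtens_index dA dB))/=; last first.
  by exists (@mxtens_unindex dA dB) => y _; rewrite (mxtens_indexK, mxtens_unindexK).
by apply: eq_bigr => -[].
Qed.

Lemma sum_ord_eq dA dB (i : 'I_dA) (F : 'I_dB -> C) (le_d : (dA <= dB)%N) :
  \sum_(k < dB) F k * (i == k :> nat)%:R = F (widen_ord le_d i).
Proof.
rewrite (bigD1 (widen_ord le_d i))//= eqxx mulr1 big1 ?addr0// => k ki.
rewrite (_ : (i == k :> nat) = false) ?mulr0//; apply: contraNF ki => /eqP e.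
exact/eqP/val_inj.
Qed.

(* sum_i c_i |ii> *)
Definition schmidt_vec dA dB (c : 'I_dA -> C) : 'cV[C]_(dA * dB) :=
  \col_x (c (mxtens_unindex x).1 *
          ((mxtens_unindex x).1 == (mxtens_unindex x).2 :> nat)%:R).

Lemma schmidt_vec_dot dA dB (c e : 'I_dA -> C) : (dA <= dB)%N ->
  (schmidt_vec dB c)^t* *m schmidt_vec dB e = (\sum_i (c i)^* * e i)%:M.
Proof.
move=> le_d; apply/matrixP => x y; rewrite !ord1 [LHS]mxE [RHS]mxE eqxx mulr1n.
rewrite sum_mxtens; apply: eq_bigr => i _.
transitivity (\sum_(k < dB) (fun=> (c i)^* * e i) k * (i == k :> nat)%:R).
  apply: eq_bigr => k _; rewrite adjmxE !mxE mxtens_indexK/= rmorphM/= conjC_nat.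
  by case: (_ == _); rewrite ?mulr0 ?mulr1.
exact: sum_ord_eq.
Qed.

Lemma schmidt_vec_comb dA dB (c e : 'I_dA -> C) (a b : C) :
  a *: schmidt_vec dB c + b *: schmidt_vec dB e =
  schmidt_vec dB (fun i => a * c i + b * e i).
Proof. by apply/matrixP => x y; rewrite !mxE; ring. Qed.

End Diagonal.

Section Explicit.
Local Open Scope complex_scope.
Local Open Scope sesquilinear_scope.
Variable R : realType.
Local Notation C := R[i].

Lemma entropy_dg n (r : 'I_n -> R) :
  entropy (dg (fun i => (r i)%:C)) = - \sum_i xlnx (r i).
Proof.
set rho := dg _.
have rh : rho \is hermsymmx.
  apply/hermsymmxP/matrixP => i j; rewrite adjmxE !mxE eq_sym.
  by case: eqP => [->|_]; rewrite ?mulr0n ?mulr1n ?conjC0 ?conjC_real.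
have rE := herm_conjdg rh.
rewrite /entropy hermfun_conjdg.
rewrite (conjdg_dg_fun (spectral_unitarymx rho) rE (g := fun i => (ln (r i))%:C)); last first.
  by move=> i j /complexI ->.
rewrite dgM mxtrace_diag Re_sum; congr (- _); apply: eq_bigr => i _.
by rewrite mxE Re_realM.
Qed.

Lemma cube_root_cases (x : R) : x * (x * x) = x -> [\/ x = 0, x = 1 | x = -1].
Proof.
move=> h; have : x * (x - 1) * (x + 1) = x * (x * x) - x by ring.
rewrite h subrr => /eqP.
rewrite !mulf_eq0 subr_eq0 addr_eq0 => /orP[/orP[]|] /eqP ->; by constructor.
Qed.

(** The hypothesis confines the eigenvalues [x] to [0], [1] and [-1], where [e^(-i t x)] agrees with
    the quadratic polynomial [1 - i x sin t + x^2 (cos t - 1)]. *)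
Lemma evolution_cubic n (H : 'M[C]_n) t : H \is hermsymmx -> H *m (H *m H) = H ->
  evolution H t = 1%:M + (- 'i%C * (sin t)%:C) *: H + (cos t - 1)%:C *: (H *m H).
Proof.
move=> Hh H3; have HE := herm_conjdg Hh; have Pu := spectral_unitarymx H.
have h3 i : [\/ eigs H i = 0, eigs H i = 1 | eigs H i = -1].
  apply: cube_root_cases; apply: complexI; rewrite !rmorphM.
  exact: conjdg_cube Pu HE H3 i.
rewrite evolution_conjdg; apply: (conjdg_quadratic Pu HE) => i.
have [->|->|->] := h3 i; rewrite /cis ?(mulr0, mulr1, mulrN, cosN, sinN, cos0, sin0).
- by rewrite oppr0 !addr0.
- by apply/eqP; rewrite eq_complex/=; apply/andP; split; apply/eqP; ring.
- by apply/eqP; rewrite eq_complex/=; apply/andP; split; apply/eqP; ring.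
Qed.

Lemma evolution_rot n (u f : 'cV[C]_n) (s a b t : R) :
  u^t* *m u = 1%:M -> f^t* *m f = 1%:M -> u^t* *m f = 0 -> s ^+ 2 = 1 ->
  evolution (s%:C *: two_level_ham u f) t *m (a%:C *: u + b%:C *: f) =
  (a * cos t + s * b * sin t)%:C *: u + (b * cos t - s * a * sin t)%:C *: f.
Proof.
move=> uu ff uf s2.
have sC2 : s%:C ^+ 2 = 1 :> C by rewrite -rmorphXn s2.
have Hh : s%:C *: two_level_ham u f \is hermsymmx.
  by apply/hermsymmxP; apply: rotZ_adj; exact: conjC_real.
rewrite (evolution_cubic _ Hh (rotZ3 uu ff uf sC2)) rmorphB/= complexiE.
rewrite (rotZ_evolve uu ff uf _ _ _ _ sC2).
by rewrite !(rmorphB, rmorphD, rmorphM).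
Qed.

End Explicit.

Section Optimum.
Local Open Scope complex_scope.
Local Open Scope sesquilinear_scope.
Variable R : realType.
Local Notation C := R[i].

Lemma reduced_schmidt_vec dA dB (c : 'I_dA -> C) : (dA <= dB)%N ->
  reduced (schmidt_vec dB c) = dg (fun i => c i * ((c i)^*)%R).
Proof.
move=> le_d; apply/matrixP => i j; rewrite [LHS]mxE [RHS]mxE.
transitivity (\sum_(k < dB) (c i * ((c j)^*)%R * (j == k :> nat)%:R) * (i == k :> nat)%:R).
  apply: eq_bigr => k _; rewrite !mxE big_ord1 !mxE !mxtens_indexK/= rmorphM/= conjC_nat.
  by ring.
rewrite sum_ord_eq mxE eq_sym/= -val_eqE/=.
by case: eqP => [/val_inj ->|_]; rewrite ?mulr1 ?mulr0.
Qed.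

Lemma ket2_0 dA dB : ket2 R dA dB 0 = schmidt_vec dB (fun i => (i == 0 :> nat)%:R).
Proof.
apply/matrixP => x y; rewrite !mxE.
case: eqP => [->|_]; last by rewrite !mul0r.
by rewrite eq_sym.
Qed.

Lemma sum_ket2 dA dB : \sum_(1 <= k < dA) ket2 R dA dB k =
  schmidt_vec dB (fun i => (i != 0 :> nat)%:R).
Proof.
apply/matrixP => x y; rewrite summxE !mxE.
set i := (mxtens_unindex x).1; set j := (mxtens_unindex x).2.
transitivity (\sum_(1 <= k < dA | k == i) (j == i :> nat)%:R : C).
  rewrite [RHS]big_mkcond/=; apply: eq_bigr => k _; rewrite !mxE -/i -/j eq_sym.
  by have [->|_] := eqVneq (k : nat) i; rewrite ?mul1r ?mul0r.
rewrite big_nat1_eq ltn_ord andbT lt0n.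
by case: (_ != _); rewrite ?mul1r ?mul0r// eq_sym.
Qed.

Lemma phiE dA dB : phi R dA dB =
  schmidt_vec dB (fun i => ((Num.sqrt (dA%:R - 1 : R))^-1)%:C * (i != 0 :> nat)%:R).
Proof. by rewrite /phi sum_ket2; apply/matrixP => x y; rewrite !mxE; ring. Qed.

End Optimum.

(** * Rate of the optimal pair *)

Section Derivatives.
Variable R : realType.

(** The function is the entropy of a spike as a function of its weight, with [D = d - 1]. The
    derivative changes sign at [1 / (D + 1)], the uniform weight. *)
Lemma is_derive_spike_entropy (D g : R) : 0 < D -> 0 < g < 1 ->
  is_derive g 1 (fun x => - (xlnx x + D * xlnx ((1 - x) / D)))
    (- ln (g * D / (1 - g))).
Proof.
move=> D0 /andP[g0 g1]; have g1' : 0 < 1 - g by rewrite subr_gt0.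
have y0 : 0 < (1 - g) / D by rewrite divr_gt0.
have da : is_derive g 1 (fun x : R => (1 - x) / D) (- D^-1).
  have -> : (fun x : R => (1 - x) / D) = D^-1 \*: (cst 1 - id).
    by apply/funext => x; rewrite fctE /= mulrC.
  by apply: is_derive_eq; rewrite /GRing.scale/= sub0r mulrN mulr1.
have d1 := is_derive_xlnx g0.
have d2 : is_derive g 1 (fun x => xlnx ((1 - x) / D)) _ :=
  @is_derive1_comp R (@xlnx R) (fun x => (1 - x) / D) g _ _ (is_derive_xlnx y0) da.
have -> : (fun x => - (xlnx x + D * xlnx ((1 - x) / D))) =
    - ((@xlnx R) + D \*: (fun x => xlnx ((1 - x) / D))) by [].
apply: is_derive_eq; rewrite /GRing.scale/=.
rewrite !ln_div ?posrE ?mulr_gt0// lnM ?posrE//; field; exact: lt0r_neq0.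
Qed.

Lemma is_derive_rotation_sqr (a b s : R) :
  is_derive (0 : R) 1 (fun t : R => (a * cos t + s * b * sin t) ^+ 2) (2 * (s * a * b)).
Proof.
have -> : (fun t : R => (a * cos t + s * b * sin t) ^+ 2) =
   (a \*: (@cos R) + (s * b) \*: (@sin R)) ^+ 2 by [].
apply: is_derive_eq; rewrite /GRing.scale/= !fctE/= cos0 sin0.
rewrite scaler0 addr0 expr1 [a%:A]mulr1; ring.
Qed.

End Derivatives.

Section Gamma_opt.
Local Open Scope complex_scope.
Local Open Scope sesquilinear_scope.
Variable R : realType.
Local Notation C := R[i].
Variables (n dB : nat).
Hypothesis le_d : (n.+2 <= dB)%N.
Local Notation u := (ket2 R n.+2 dB 0).
Local Notation f := (phi R n.+2 dB).

Let D0 : 0 < n.+1%:R :> R. Proof. by rewrite ltr0n. Qed.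

Lemma ket2_unit : u^t* *m u = 1%:M.
Proof.
rewrite ket2_0 schmidt_vec_dot// big_ord_recl/= big1 => [|i _]; last by rewrite mulr0.
by rewrite conjC_nat mulr1 addr0.
Qed.

Lemma phi_unit : f^t* *m f = 1%:M.
Proof.
rewrite phiE natrS_subr1 schmidt_vec_dot// big_ord_recl/= !mulr0 add0r.
rewrite (eq_bigr (fun=> (n.+1%:R^-1)%:C)) => [|i _]; last first.
  rewrite mulr1 conjC_real -rmorphM/= -invfM -expr2 sqr_sqrtr// ltW//.
by rewrite sumr_const card_ord -rmorphMn/= -[_ *+ _]mulr_natr mulVf ?gt_eqF.
Qed.

Lemma ket2_phi : u^t* *m f = 0.
Proof.
rewrite ket2_0 phiE schmidt_vec_dot// big1 ?raddf0// => i _.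
by case: (_ == _); rewrite ?mulr0 ?conjC0 ?mul0r.
Qed.

Lemma psi_optE (g : R) : 0 < g < 1 ->
  psi_opt n.+2 dB g = (Num.sqrt g)%:C *: u + (Num.sqrt (1 - g))%:C *: f.
Proof.
move=> /andP[g0 g1].
have e : Num.sqrt ((1 - g) / n.+1%:R) = Num.sqrt (1 - g) * (Num.sqrt n.+1%:R)^-1.
  by rewrite sqrtrM ?subr_ge0 ?ltW// sqrtrV// ltW.
by rewrite /psi_opt /phi natrS_subr1 e scalerA rmorphM.
Qed.

Lemma ham_optE (g : R) : ham_opt n.+2 dB g =
  (if n.+2%:R^-1 < g then -1 else 1)%:C *: two_level_ham u f.
Proof.
rewrite /ham_opt /two_level_ham -complexiE -/(ham R n.+2 dB).
by case: ifP => _; rewrite ?scale1r// rmorphN scaleN1r.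
Qed.

(** The vector is in Schmidt form, so its reduced state is diagonal; the entries are the spike
    distribution of weight [a ^+ 2]. *)
Lemma entropy_comb (a b : R) : a ^+ 2 + b ^+ 2 = 1 ->
  entropy (reduced (a%:C *: u + b%:C *: f)) =
  - (xlnx (a ^+ 2) + n.+1%:R * xlnx ((1 - a ^+ 2) / n.+1%:R)).
Proof.
move=> ab; have b2 : b ^+ 2 = 1 - a ^+ 2 by rewrite -ab addrC addKr.
rewrite ket2_0 phiE natrS_subr1 schmidt_vec_comb reduced_schmidt_vec//.
rewrite -(spike_dist_sum (@xlnx R)) -entropy_dg; congr entropy; congr dg.
apply/funext => i; rewrite /spike_dist natrS_subr1.
case: eqP => _ /=.
  by rewrite !mulr0 addr0 mulr1 conjC_real -rmorphM expr2.
rewrite !mulr0 add0r !mulr1 -rmorphM conjC_real -rmorphM/=; congr (_%:C).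
by rewrite mulrACA -expr2 -invfM -expr2 sqr_sqrtr ?ltW// b2.
Qed.

(** Chain rule: the weight of [|00>] moves with initial velocity [2 s a b], where [a] and [b] are
    the two amplitudes, and the entropy depends on time through this weight only. *)
Lemma Gamma_rotation (g s : R) : 0 < g < 1 -> s ^+ 2 = 1 ->
  Gamma (psi_opt n.+2 dB g) (s%:C *: two_level_ham u f) =
  2 * Num.sqrt (g * (1 - g)) * (- s * ln (g * n.+1%:R / (1 - g))).
Proof.
move=> g01 s2; have /andP[g0 g1] := g01.
set a := Num.sqrt g; set b := Num.sqrt (1 - g).
have a2 : a ^+ 2 = g by rewrite sqr_sqrtr// ltW.
have b2 : b ^+ 2 = 1 - g by rewrite sqr_sqrtr// subr_ge0 ltW.
rewrite psi_optE// -/a -/b /Gamma.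
pose x t := (a * cos t + s * b * sin t) ^+ 2.
have -> : (fun t => entanglement (evolution (s%:C *: two_level_ham u f) t *m
      ((a%:C *: u + b%:C *: f) *m (a%:C *: u + b%:C *: f)^t*) *m
      evolution (s%:C *: two_level_ham u f) (- t))) =
    (fun x => - (xlnx x + n.+1%:R * xlnx ((1 - x) / n.+1%:R))) \o x.
  apply/funext => t; rewrite /entanglement evolve_pure.
  rewrite (evolution_rot _ _ _ ket2_unit phi_unit ket2_phi s2) -/(reduced _).
  rewrite entropy_comb//.
  have := cos2Dsin2 t; have : a ^+ 2 + b ^+ 2 = 1 by rewrite a2 b2; ring.
  move=> ab cs.
  have -> : (a * cos t + s * b * sin t) ^+ 2 + (b * cos t - s * a * sin t) ^+ 2 =
    (a ^+ 2 + b ^+ 2) * cos t ^+ 2 + (s ^+ 2) * (a ^+ 2 + b ^+ 2) * sin t ^+ 2 by ring.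
  by rewrite ab s2 !mul1r.
have x0 : x 0 = g by rewrite /x cos0 sin0 mulr0 addr0 mulr1.
have dF := is_derive_spike_entropy D0 g01.
rewrite -x0 in dF.
have dc := is_derive1_comp dF (is_derive_rotation_sqr a b s).
rewrite derive1E (@derive_val _ _ _ _ _ _ _ dc) x0 sqrtrM ?ltW// -/a -/b.
ring.
Qed.

Lemma Gamma_psi_opt (g : R) : 0 < g < 1 ->
  Gamma (psi_opt n.+2 dB g) (ham_opt n.+2 dB g) =
  2 * Num.sqrt (surprisal_variance (@spike_dist R n.+2 g)).
Proof.
move=> g01; have /andP[g0 g1] := g01; have g1' : 0 < 1 - g by rewrite subr_gt0.
rewrite two_sqrt_variance_spike// ham_optE Gamma_rotation//; last first.
  by case: ifP; rewrite ?sqrrN expr1n.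
congr (_ * _).
(* The test in [ham_opt] is rephrased as positivity of the logarithm, so that the chosen sign
   produces its absolute value. *)
have -> : (n.+2%:R^-1 < g) = (1 < g * n.+1%:R / (1 - g)).
  rewrite ltr_pdivlMr// mul1r -(natr1 n.+1) -[X in X < g]mul1r ltr_pdivrMr ?addr_gt0//.
  by apply/idP/idP; lra.
case: ifPn => [h|]; first by rewrite opprK mul1r gtr0_norm// ln_gt0.
by rewrite -leNgt => h; rewrite mulN1r ler0_norm// ln_le0.
Qed.

(** The mean energy is zero, and the square of the Hamiltonian fixes the state, so the variance is
    [1]. *)
Lemma admissible_opt (g : R) : 0 < g < 1 ->
  admissible (psi_opt n.+2 dB g) (ham_opt n.+2 dB g).
Proof.
move=> g01; have /andP[g0 g1] := g01.
have ab : (Num.sqrt g)%:C ^+ 2 + (Num.sqrt (1 - g))%:C ^+ 2 = 1 :> C.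
  by rewrite -!rmorphXn/= !sqr_sqrtr ?subr_ge0 ?ltW// -rmorphD/= addrC subrK.
have ar := conjC_real (Num.sqrt g); have br := conjC_real (Num.sqrt (1 - g)).
rewrite psi_optE// ham_optE; set s := (if _ then _ else _)%:C.
have sr : (s^*)%R = s by exact: conjC_real.
have s2 : s ^+ 2 = 1 by rewrite /s; case: ifP => _; rewrite ?rmorphN ?sqrrN expr1n.
split.
- exact: pure_comb ket2_unit phi_unit ket2_phi _ _ ar br ab.
- by apply/hermsymmxP; apply: rotZ_adj.
- rewrite /energy_variance !expectation_braket rotZ_sqr// braketZ.
  rewrite (braket_rot ket2_unit phi_unit ket2_phi ar br).
  rewrite (braket_rot2 ket2_unit phi_unit ket2_phi ar br ab).
  by rewrite mulr0 expr0n subr0.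
Qed.

End Gamma_opt.

Unset Implicit Arguments.

Theorem mainTheorem4 (R : realType) (dA dB : nat)
    (dA_ge2 : (2 <= dA)%N) (dA_le_dB : (dA <= dB)%N) :
  (exists gamma : R, optimal_weight dA gamma) /\
  exists M : R,
    [/\ is_max [set r | exists (psi : 'cV[R[i]]_(dA * dB))
                               (H : 'M[R[i]]_(dA * dB)),
                  admissible psi H /\ Gamma psi H = r] M,
        forall gamma : R, optimal_weight dA gamma ->
          admissible (psi_opt dA dB gamma) (ham_opt dA dB gamma) /\
          Gamma (psi_opt dA dB gamma) (ham_opt dA dB gamma) = M
      & is_max [set r | exists2 gamma : R, 0 < gamma < 1 &
                  2 * Num.sqrt (gamma * (1 - gamma))
                    * ln (gamma * (dA%:R - 1) / (1 - gamma)) = r] M].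
Proof.
case: dA dA_ge2 dA_le_dB => [//|[//|n]] _ le_d.
(* The bound [1/2 <= g] gives [g (d - 1) / (1 - g) >= 1], which makes the logarithm of the last
   maximum nonnegative at [g]. *)
have [g /andP[g2 g1] gmax] := @surprisal_variance_le_spike R n.
have g01 : 0 < g < 1 by rewrite g1 andbT; lra.
have spike_opt : optimal_weight n.+2 g.
  split=> //; split; first by exists (@spike_dist R n.+2 g) => //; exact: prob_dist_spike.
  by move=> _ [p pd <-]; exact: gmax.
split; first by exists g.
set V := surprisal_variance (@spike_dist R n.+2 g).
exists (2 * Num.sqrt V); split.
- split; first by exists (psi_opt n.+2 dB g), (ham_opt n.+2 dB g);
    split; [exact: admissible_opt|exact: Gamma_psi_opt].
  move=> _ [psi [H [adm <-]]]; have [p pd /le_trans] := Gamma_le adm.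
  by apply; rewrite ler_pM2l// ler_wsqrtr// gmax.
(* Two spikes that both maximize the variance have equal variance, hence equal rate. *)
- move=> h [h01 [[p pd pV] hmax]]; split; first exact: admissible_opt.
  rewrite Gamma_psi_opt//; congr (2 * Num.sqrt _); apply/eqP; rewrite eq_le.
  rewrite gmax ?hmax//; last exact: prob_dist_spike.
  by exists (@spike_dist R n.+2 g) => //; exact: prob_dist_spike.
- rewrite natrS_subr1; split.
    exists g => //; rewrite /V two_sqrt_variance_spike//; congr (_ * _).
    rewrite ger0_norm// ln_ge0// ler_pdivlMr ?subr_gt0// mul1r.
    have : 1 <= n.+1%:R :> R by rewrite ler1n.
    by nra.
  (* At an arbitrary weight the logarithm may be negative; it is at most its absolute value, which
     belongs to the variance of that spike. *)
  move=> _ [h h01 <-].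
  apply: (@le_trans _ _ (2 * Num.sqrt (surprisal_variance (@spike_dist R n.+2 h)))).
    by rewrite two_sqrt_variance_spike// ler_wpM2l ?mulr_ge0 ?sqrtr_ge0// ler_norm.
  by rewrite ler_pM2l// ler_wsqrtr// gmax//; exact: prob_dist_spike.
Qed.
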